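(* Let $\boldsymbol\alpha\in\mathbb C^d$. Then ${\rm Ann}(L(\boldsymbol\alpha))=0$ if and only if the equivalence class $[\boldsymbol\alpha]$ is extreme and $\mathbb R_{>0}(\boldsymbol\alpha)$ is nonempty.
   Context: $A\subset\mathbb Z^d$ is a finite set generating the group $\mathbb Z^d$; $\mathbb NA$ its monoid; $R_A=\mathbb C[\mathbb NA]\subseteq\mathbb C[t_1^{\pm1},\dots,t_d^{\pm1}]$; $D(R_A)=\{P\in\mathbb C[t^{\pm1}]\langle\partial_1,\dots,\partial_d\rangle:P(R_A)\subseteq R_A\}$; $s_j=t_j\partial_j$. $L(\boldsymbol\alpha)$ is the unique simple quotient of $M(\boldsymbol\alpha)=D(R_A)/\sum_iD(R_A)(s_i-\alpha_i)$ in the category of left $D(R_A)$-modules that are direct sums of finite-dimensional weight spaces $\{x:f(s)x=f(\boldsymbol\lambda)x\ \forall f\in\mathbb C[s]\}$. For a face $\tau$ of $\mathbb R_{\ge0}A$, $E_\tau(\boldsymbol\alpha)=\{\boldsymbol\lambda\in\mathbb C(A\cap\tau)/\mathbb Z(A\cap\tau):\boldsymbol\alpha-\boldsymbol\lambda\in\mathbb NA+\mathbb Z(A\cap\tau)\}$, called full if it has $[\mathbb Q(A\cap\tau)\cap\mathbb Z^d:\mathbb Z(A\cap\tau)]$ elements; $\boldsymbol\alpha\sim\boldsymbol\beta$ iff $E_\tau(\boldsymbol\alpha)=E_\tau(\boldsymbol\beta)$ for all faces $\tau$, $[\boldsymbol\alpha]$ the class. For a facet $\sigma$, $F_\sigma$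 is the unique linear form (extended $\mathbb C$-linearly) with $F_\sigma(\mathbb R_{\ge0}A)\ge0$, $F_\sigma(\sigma)=0$, $F_\sigma(\mathbb Z^d)=\mathbb Z$. $\mathcal F_+(\boldsymbol\alpha)=\{\sigma:F_\sigma(\boldsymbol\alpha)\in F_\sigma(\mathbb NA)\}$, $\mathcal F_-(\boldsymbol\alpha)=\{\sigma:F_\sigma(\boldsymbol\alpha)\in\mathbb Z\setminus F_\sigma(\mathbb NA)\}$, $\mathbb R_{>0}(\boldsymbol\alpha)=\{\boldsymbol\gamma\in\mathbb R^d:F_\sigma(\boldsymbol\gamma)>0\ (\sigma\in\mathcal F_+(\boldsymbol\alpha)),\ F_\sigma(\boldsymbol\gamma)<0\ (\sigma\in\mathcal F_-(\boldsymbol\alpha))\}$. ${\rm Face}(\boldsymbol\alpha)$ is the set of faces $\tau$ such that $\boldsymbol\alpha-\boldsymbol\lambda\in\mathbb Z^d$ for some $\boldsymbol\lambda\in\mathbb C(A\cap\tau)$ and every facet containing $\tau$ lies in $\mathcal F_+(\boldsymbol\alpha)$. $[\boldsymbol\alpha]$ is extreme if $E_\tau(\boldsymbol\alpha)$ is full for all $\tau\in{\rm Face}(\boldsymbol\alpha)$ and empty for all $\tau\notin{\rm Face}(\boldsymbol\alpha)$. *)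

(* Defs.v *)
From HB Require Import structures.
From mathcomp Require Import all_boot all_order all_algebra.
From mathcomp Require Import finmap.
From mathcomp Require Import reals.
From mathcomp Require Import complex.
From mathcomp Require Import monalg.
From mathcomp Require Import mpoly.

Set Implicit Arguments.
Unset Strict Implicit.
Unset Printing Implicit Defensive.

Import Order.TTheory GRing.Theory Num.Theory.
Local Open Scope ring_scope.

Section ToricD.
Variable R : realType.
Local Notation C := (complex R).
Variable d : nat.
Variable A : seq 'rV[int]_d.
Local Notation n := (size A).

Definition zR (z : 'rV[int]_d) : 'rV[R]_d := map_mx (fun k : int => k%:~R) z.
Definition zC (z : 'rV[int]_d) : 'rV[C]_d := map_mx (fun k : int => k%:~R) z.

Definition dotZ (l z : 'rV[int]_d) : int := \sum_(j < d) l 0 j * z 0 j.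
Definition dotR (l x : 'rV[R]_d) : R := \sum_(j < d) l 0 j * x 0 j.
Definition dotC (l x : 'rV[C]_d) : C := \sum_(j < d) l 0 j * x 0 j.

Definition generates : Prop :=
  forall z : 'rV[int]_d, exists c : 'I_n -> int, z = \sum_(i < n) c i *: A`_i.

Definition inNA (z : 'rV[int]_d) : Prop :=
  exists c : 'I_n -> nat, z = \sum_(i < n) A`_i *+ c i.

Definition in_cone (x : 'rV[R]_d) : Prop :=
  exists c : 'I_n -> R, (forall i, 0 <= c i) /\ x = \sum_(i < n) c i *: zR A`_i.

Definition is_face (tau : 'rV[R]_d -> Prop) : Prop :=
  exists l : 'rV[R]_d, (forall x, in_cone x -> 0 <= dotR l x) /\
    forall x, tau x <-> (in_cone x /\ dotR l x = 0).

(* a facet: a face whose linear span has dimension d - 1 *)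
Definition is_facet (sigma : 'rV[R]_d -> Prop) : Prop :=
  [/\ is_face sigma,
      (0 < d)%N,
      (exists M : 'M[R]_(d.-1, d), (forall k, sigma (row k M)) /\ row_free M)
    & ~ (exists M : 'M[R]_(d, d), (forall k, sigma (row k M)) /\ row_free M)].

Definition facet_form (sigma : 'rV[R]_d -> Prop) (F : 'rV[int]_d) : Prop :=
  [/\ forall x, in_cone x -> 0 <= dotR (zR F) x,
      forall x, sigma x -> dotR (zR F) x = 0
    & forall k : int, exists z : 'rV[int]_d, dotZ F z = k].

Definition Fplus (alpha : 'rV[C]_d) (sigma : 'rV[R]_d -> Prop) : Prop :=
  forall F, facet_form sigma F ->
    exists z, inNA z /\ dotC (zC F) alpha = (dotZ F z)%:~R.

Definition Fminus (alpha : 'rV[C]_d) (sigma : 'rV[R]_d -> Prop) : Prop :=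
  forall F, facet_form sigma F ->
    (exists k : int, dotC (zC F) alpha = k%:~R) /\
    ~ (exists z, inNA z /\ dotC (zC F) alpha = (dotZ F z)%:~R).

Definition Rpos (alpha : 'rV[C]_d) (gamma : 'rV[R]_d) : Prop :=
  forall sigma, is_facet sigma ->
    (Fplus alpha sigma -> forall F, facet_form sigma F -> 0 < dotR (zR F) gamma) /\
    (Fminus alpha sigma -> forall F, facet_form sigma F -> dotR (zR F) gamma < 0).

Definition spanC (tau : 'rV[R]_d -> Prop) (v : 'rV[C]_d) : Prop :=
  exists c : 'I_n -> C, (forall i, c i != 0 -> tau (zR A`_i)) /\
    v = \sum_(i < n) c i *: zC A`_i.
Definition spanZ (tau : 'rV[R]_d -> Prop) (v : 'rV[C]_d) : Prop :=
  exists c : 'I_n -> int, (forall i, c i != 0 -> tau (zR A`_i)) /\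
    v = \sum_(i < n) (c i)%:~R *: zC A`_i.
Definition spanQZ (tau : 'rV[R]_d -> Prop) (v : 'rV[C]_d) : Prop :=
  (exists z : 'rV[int]_d, v = zC z) /\
  exists c : 'I_n -> rat, (forall i, c i != 0 -> tau (zR A`_i)) /\
    v = \sum_(i < n) ratr (c i) *: zC A`_i.
Definition NAC (v : 'rV[C]_d) : Prop := exists z, inNA z /\ v = zC z.

(* lambda represents an element of E_tau(alpha) ⊆ C(A∩tau)/Z(A∩tau) *)
Definition inE (tau : 'rV[R]_d -> Prop) (alpha lam : 'rV[C]_d) : Prop :=
  spanC tau lam /\
  exists x y, [/\ NAC x, spanZ tau y & alpha - lam = x + y].

(* the set S (a union of L-cosets) consists of exactly m cosets modulo L *)
Definition card_mod (S L : 'rV[C]_d -> Prop) (m : nat) : Prop :=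
  exists s : 'I_m -> 'rV[C]_d,
    [/\ forall k, S (s k),
        forall k k', L (s k - s k') -> k = k'
      & forall v, S v -> exists k, L (v - s k)].

Definition Efull (tau : 'rV[R]_d -> Prop) (alpha : 'rV[C]_d) : Prop :=
  exists m, card_mod (inE tau alpha) (spanZ tau) m /\
            card_mod (spanQZ tau) (spanZ tau) m.

Definition Eempty (tau : 'rV[R]_d -> Prop) (alpha : 'rV[C]_d) : Prop :=
  ~ exists lam, inE tau alpha lam.

Definition inFace (alpha : 'rV[C]_d) (tau : 'rV[R]_d -> Prop) : Prop :=
  [/\ is_face tau,
      exists lam, spanC tau lam /\ exists z, alpha - lam = zC z
    & forall sigma, is_facet sigma -> (forall x, tau x -> sigma x) ->
        Fplus alpha sigma].

Definition extreme (alpha : 'rV[C]_d) : Prop :=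
  forall tau, is_face tau ->
    (inFace alpha tau -> Efull tau alpha) /\
    (~ inFace alpha tau -> Eempty tau alpha).

(* An element of C[t^{±1}]<d_1..d_d> is written uniquely as a finite sum
   sum_a t^a f_a(s) with f_a ∈ C[s_1..s_d], s_j = t_j d_j; we represent it by
   the finitely supported map a |-> f_a. *)
Local Notation Weyl := (@monalg.malg 'rV[int]_d (mpoly d C)).
Local Notation Laurent := (@monalg.malg 'rV[int]_d C).

Definition shiftp (f : (mpoly d C)) (b : 'rV[int]_d) : (mpoly d C) :=
  comp_mpoly [tuple ('X_i + ((b 0 i)%:~R : C)%:MP_[d]) | i < d] f.

(* product: (t^a f(s)) (t^b g(s)) = t^(a+b) f(s+b) g(s) *)
Definition mulW (P Q : Weyl) : Weyl :=
  \sum_(a <- monalg.msupp P) \sum_(b <- monalg.msupp Q)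
     monalg.mkmalgU (a + b)
       (shiftp (monalg.mcoeff a P) b * monalg.mcoeff b Q).

Definition oneW : Weyl := monalg.mkmalgU 0 1.

Definition sW (alpha : 'rV[C]_d) (i : 'I_d) : Weyl :=
  monalg.mkmalgU 0 ('X_i - (alpha 0 i)%:MP_[d]).

(* action on Laurent polynomials: (t^a f(s)) t^c = f(c) t^(a+c) *)
Definition actW (P : Weyl) (u : Laurent) : Laurent :=
  \sum_(a <- monalg.msupp P) \sum_(c <- monalg.msupp u)
     monalg.mkmalgU (a + c)
       (meval (fun i : 'I_d => ((c 0 i)%:~R : C)) (monalg.mcoeff a P)
          * monalg.mcoeff c u).

Definition inRA (u : Laurent) : Prop := forall c, c \in monalg.msupp u -> inNA c.

Definition inD (P : Weyl) : Prop := forall u, inRA u -> inRA (actW P u).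

(* the left ideal J = sum_i D(R_A)(s_i - alpha_i), so M(alpha) = D(R_A)/J *)
Definition Jid (alpha : 'rV[C]_d) (x : Weyl) : Prop :=
  exists q : 'I_d -> Weyl, (forall i, inD (q i)) /\
    x = \sum_(i < d) mulW (q i) (sW alpha i).

Definition left_idealD (K : Weyl -> Prop) : Prop :=
  [/\ forall x, K x -> inD x, K 0,
      forall x y, K x -> K y -> K (x + y)
    & forall p x, inD p -> K x -> K (mulW p x)].

(* proper submodules of M(alpha) <-> left ideals K with J ⊆ K, 1 ∉ K *)
Definition proper_sub (alpha : 'rV[C]_d) (K : Weyl -> Prop) : Prop :=
  [/\ left_idealD K, forall x, Jid alpha x -> K x & ~ K oneW].

(* N(alpha): the sum of all proper submodules (preimage in D(R_A));
   L(alpha) = M(alpha)/N(alpha) = D(R_A)/N(alpha) *)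
Definition Nid (alpha : 'rV[C]_d) (x : Weyl) : Prop :=
  exists s : seq Weyl,
    (forall y, y \in s -> exists K, proper_sub alpha K /\ K y) /\
    x = \sum_(y <- s) y.

Definition annL_zero (alpha : 'rV[C]_d) : Prop :=
  forall P, inD P -> (forall x, inD x -> Nid alpha (mulW P x)) -> P = 0.

End ToricD.

(* Main.v *)
(* D(R_A) is the sum of the t^a I_a, where I_a is the ideal of polynomials
   vanishing on {c in NA : a + c not in NA}.  Hence L(alpha) has the weights
   alpha + b with b in
     W = {b : some f in I_b has f(alpha) <> 0, some g in I_(-b) has g(alpha + b) <> 0},
   and Ann L(alpha) = 0 iff no nonzero polynomial vanishes at all alpha + b with
   b in W and a + b in W, whatever a is.

   An element of I_b not vanishing at alpha exists iff E_tau(alpha) is contained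
   in E_tau(alpha + b) for all faces tau, so W = {b : alpha + b ~ alpha}.  For "if"
   one takes a product of factors F_sigma(s) - k over the facets sigma.

   If W is Zariski dense, some b in W makes every integral F_sigma(alpha + b)
   negative or very large; then Re (alpha + b) lies in R_>0(alpha), and E_tau is
   full at alpha + b, hence at alpha, for tau in Face(alpha).  Conversely, if alpha
   is extreme then W contains all b with F_sigma(alpha + b) large on F_+ and
   negative on F_-; when R_>0(alpha) is nonempty these b contain the far end of
   every line in some fixed integral direction, and this forces density. *)

Require Import Defs.
From HB Require Import structures.
From mathcomp Require Import all_boot all_order all_algebra.
From mathcomp Require Import finmap boolp.
From mathcomp Require Import reals complex.
From mathcomp Require Import monalg mpoly.
From mathcomp Require Import ring lra zify.

Set Implicit Arguments.
Unset Strict Implicit.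
Unset Printing Implicit Defensive.

Import Order.TTheory GRing.Theory Num.Theory.
Local Open Scope ring_scope.

(** The obstacle is uniformity: each bound must serve infinitely many lattice points at once. The
    facet inequalities do not decide membership in NA, which has holes; near a face tau it is only
    periodic modulo Z(A \cap tau), and this lattice may have index above 1 among the integral points
    of its span. Two finiteness facts control this: that index is finite, and each face has a
    conductor, a point of its monoid beyond which membership in the group and in the cone gives
    membership in the monoid. Thresholds on the values F_sigma built from these facts say how many
    factors F_sigma(s) - k a test polynomial carries.

    Faces are given by arbitrary real functionals, whereas these factors need integral forms. The
    link is that the F_sigma are the primitive generators of the extreme rays of the dual cone:
    hence they are finitely many, and their values alone describe the cone, its faces and the spans
    of the faces. *)

Lemma big_pick (K : choiceType) (V : nmodType) (s : seq K) (G : K -> V) (e : K) :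
  uniq s -> (e \notin s -> G e = 0) -> \sum_(a <- s) G a *+ (a == e) = G e.
Proof.
move=> us Ge0; have [es|es] := boolP (e \in s).
  rewrite (bigD1_seq e) //= eqxx mulr1n big1 ?addr0 // => a /negbTE ->.
  by rewrite mulr0n.
rewrite Ge0 // big_seq big1 // => a as_.
by case: eqP => [ae|]; rewrite ?mulr0n //; rewrite -ae as_ in es.
Qed.

(** * Polynomial functions *)

Section Evaluation.
Variables (R : realType) (d : nat).
Local Notation C := (complex R).
Implicit Types (f g : mpoly d C) (v w : 'rV[C]_d).

Definition ev f v : C := meval (fun i => v 0 i) f.

Lemma ev0 v : ev 0 v = 0. Proof. exact: meval0. Qed.
Lemma evC c v : ev c%:MP v = c. Proof. exact: mevalC. Qed.
Lemma ev1 v : ev 1 v = 1. Proof. exact: meval1. Qed.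
Lemma evXU i v : ev 'X_i v = v 0 i. Proof. exact: mevalXU. Qed.
Lemma evD v : {morph ev^~ v : f g / f + g}. Proof. exact: mevalD. Qed.
Lemma evB v : {morph ev^~ v : f g / f - g}. Proof. exact: mevalB. Qed.
Lemma evM v : {morph ev^~ v : f g / f * g}. Proof. exact: mevalM. Qed.

Lemma ev_sum (I : Type) (r : seq I) (P : pred I) (F : I -> mpoly d C) v :
  ev (\sum_(i <- r | P i) F i) v = \sum_(i <- r | P i) ev (F i) v.
Proof. exact: (big_morph _ (evD v) (ev0 v)). Qed.

Lemma ev_prod (I : Type) (r : seq I) (P : pred I) (F : I -> mpoly d C) v :
  ev (\prod_(i <- r | P i) F i) v = \prod_(i <- r | P i) ev (F i) v.
Proof. exact: (big_morph _ (evM v) (ev1 v)). Qed.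

Lemma ev_shiftp f (b : 'rV[int]_d) v : ev (shiftp f b) v = ev f (v + zC R b).
Proof.
rewrite /ev /shiftp comp_mpoly_meval; apply: meval_eq => i.
by rewrite tnth_mktuple mevalD mevalXU mevalC !mxE.
Qed.

Lemma shiftp0 (b : 'rV[int]_d) : shiftp (0 : mpoly d C) b = 0.
Proof. exact: comp_mpoly0. Qed.

Lemma shiftp_id f : shiftp f 0 = f.
Proof.
rewrite /shiftp (_ : [tuple _ | i < d] = [tuple 'X_i | i < d]).
  exact: comp_mpoly_id.
by apply: eq_from_tnth => j; rewrite !tnth_mktuple mxE mpolyC0 addr0.
Qed.

Lemma mpoly_ring_ind (Q : mpoly d C -> Prop) :
  (forall c, Q c%:MP) -> (forall i, Q 'X_i) ->
  (forall f g, Q f -> Q g -> Q (f + g)) -> (forall f g, Q f -> Q g -> Q (f * g)) ->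
  forall f, Q f.
Proof.
move=> QC QX QD QM f; elim/mpolyind: f => [|c m g _ _ IH].
  by rewrite -mpolyC0; exact: QC.
apply: (QD) => //; rewrite -mul_mpolyC; apply: (QM) => //; rewrite mpolyXE_id.
apply: (big_ind Q) => [||i _]; [exact: QC|exact: QM|].
elim: (m i) => [|k IHk]; first exact: QC.
by rewrite exprS; apply: (QM).
Qed.

(** Every [g] minus its value at [v] lies in the ideal of the X_i - v_i, by ring induction. This
    turns vanishing at [alpha] into membership in [Jid]. *)
Lemma ev_eq0_ideal f v : ev f v = 0 ->
  exists h : 'I_d -> mpoly d C, f = \sum_(i < d) h i * ('X_i - (v 0 i)%:MP).
Proof.
pose Q (g : mpoly d C) :=
  exists h : 'I_d -> mpoly d C, g = \sum_(i < d) h i * ('X_i - (v 0 i)%:MP).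
have QD g1 g2 : Q g1 -> Q g2 -> Q (g1 + g2).
  move=> [h1 ->] [h2 ->]; exists (fun i => h1 i + h2 i).
  by rewrite -big_split; apply: eq_bigr => i _; rewrite mulrDl.
have QM g1 g2 : Q g2 -> Q (g1 * g2).
  move=> [h2 ->]; exists (fun i => g1 * h2 i).
  by rewrite mulr_sumr; apply: eq_bigr => i _; rewrite mulrA.
suff key g : Q (g - (ev g v)%:MP) by move=> f0; have := key f; rewrite f0 mpolyC0 subr0.
elim/mpoly_ring_ind: g => [c|i|g1 g2 q1 q2|g1 g2 q1 q2].
- by rewrite evC subrr; exists (fun=> 0); rewrite big1 // => i _; rewrite mul0r.
- rewrite evXU; exists (fun j => (j == i)%:R).
  rewrite (bigD1 i) //= eqxx mul1r big1 ?addr0 //.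
  by move=> j /negbTE ->; rewrite mul0r.
- by rewrite evD mpolyCD opprD addrACA; exact: QD.
rewrite evM mpolyCM.
have -> : g1 * g2 - (ev g1 v)%:MP * (ev g2 v)%:MP =
   g1 * (g2 - (ev g2 v)%:MP) + (ev g2 v)%:MP * (g1 - (ev g1 v)%:MP).
  by move: (_%:MP) (_%:MP) => c1 c2; ring.
by apply: QD; apply: QM.
Qed.

Lemma ev_line f v w : exists p : {poly C}, forall c, ev f (v + c *: w) = p.[c].
Proof.
elim/mpoly_ring_ind: f => [a|i|f g [p pE] [q qE]|f g [p pE] [q qE]].
- by exists a%:P => c; rewrite evC hornerC.
- exists ((v 0 i)%:P + (w 0 i) *: 'X) => c.
  by rewrite evXU !mxE hornerD hornerC hornerZ hornerX mulrC.
- by exists (p + q) => c; rewrite evD pE qE hornerD.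
- by exists (p * q) => c; rewrite evM pE qE hornerM.
Qed.

Lemma poly_nat_eq0 (p : {poly C}) n0 :
  (forall k, (n0 <= k)%N -> p.[k%:R] = 0) -> p = 0.
Proof.
move=> p0; apply/eqP; case: (eqVneq p 0) => // pn0.
have := max_poly_roots (rs := [seq k%:R | k <- iota n0 (size p)]) pn0.
rewrite size_map size_iota ltnn => -> //.
  by apply/allP => x /mapP[k]; rewrite mem_iota => /andP[nk _] ->; apply/eqP/p0.
rewrite map_inj_uniq ?iota_uniq // => k1 k2 /eqP.
by rewrite eqr_nat => /eqP.
Qed.

Lemma ev_line_eq0 f v w n0 :
  (forall k, (n0 <= k)%N -> ev f (v + k%:R *: w) = 0) ->
  forall c, ev f (v + c *: w) = 0.
Proof.
have [p pE] := ev_line f v w => f0 c.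
rewrite pE (@poly_nat_eq0 p n0) ?horner0 // => k nk; rewrite -pE; exact: f0.
Qed.

(** One coefficient at a time passes from natural to complex values, because a polynomial on a line
    that vanishes at all natural parameters is zero there. *)
Lemma ev_span_eq0 (I : eqType) (r : seq I) (P : pred I) (w : I -> 'rV[C]_d) f v :
  uniq r ->
  (forall k : I -> nat, ev f (v + \sum_(i <- r | P i) (k i)%:R *: w i) = 0) ->
  forall c : I -> C, ev f (v + \sum_(i <- r | P i) c i *: w i) = 0.
Proof.
elim: r v => [|i r IH] v /= => [_ f0 c|].
  by have := f0 (fun=> 0%N); rewrite !big_nil.
move=> /andP[ir ur] f0 c; have [Pi|Pi] := boolP (P i); last first.
  rewrite big_cons (negbTE Pi); apply: IH => // k.
  by have := f0 k; rewrite big_cons (negbTE Pi).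
rewrite big_cons Pi addrA; apply: IH => // k.
rewrite addrAC; apply: (@ev_line_eq0 _ _ _ 0%N) => m _.
have := f0 (fun j => if j == i then m else k j).
rewrite big_cons Pi eqxx addrCA addrC; congr (ev _ (_ + _ + _) = _).
rewrite big_seq_cond [RHS]big_seq_cond; apply: eq_bigr => j /andP[jr _].
by case: eqP => // ji; rewrite -ji jr in ir.
Qed.

Lemma digits_inj N n (m m' : 'I_n -> nat) :
  (forall i, m i < N)%N -> (forall i, m' i < N)%N ->
  (\sum_i m i * N ^ i = \sum_i m' i * N ^ i)%N -> m =1 m'.
Proof.
elim: n m m' => [|n IH] m m' mN m'N; first by move=> _ [].
have N0 : (0 < N)%N by apply: leq_ltn_trans (mN ord0).
have E (u : 'I_n.+1 -> nat) : (\sum_(i < n.+1) u i * N ^ i =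
   (\sum_(i < n) u (lift ord0 i) * N ^ i) * N + u ord0)%N.
  rewrite big_ord_recl expn0 muln1 addnC big_distrl; congr (_ + _)%N.
  by apply: eq_bigr => i _; rewrite /= /bump leq0n add1n expnSr mulnA.
rewrite !E => eqm.
have e0 : m ord0 = m' ord0.
  by have := congr1 (modn^~ N) eqm; rewrite /= !modnMDl !modn_small.
move: eqm; rewrite e0 => /addIn /eqP; rewrite eqn_pmul2r // => /eqP /IH eqm i.
case: (unliftP ord0 i) => [j ->|-> //]; apply: eqm => {}j; [exact: mN|exact: m'N].
Qed.

(* Kronecker substitution [X_i := c ^ (N ^ i)] separates the monomials of [f]. *)
Lemma ev_inj0 f : (forall v, ev f v = 0) -> f = 0.
Proof.
move=> f0; pose N := (msize f).+1.
pose key (m : 'X_{1..d}) := (\sum_(i < d) m i * N ^ i)%N.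
have mN m (i : 'I_d) : m \in msupp f -> (m i < N)%N.
  move=> /msize_mdeg_lt mf; rewrite ltnS; apply: leq_trans (ltnW mf).
  by rewrite mdegE (bigD1 i) //= leq_addr.
pose p : {poly C} := \sum_(m <- msupp f) f@_m *: 'X^(key m).
have p0 : p = 0.
  apply: (@poly_nat_eq0 _ 0) => k _.
  have := f0 (\row_i (k%:R ^+ (N ^ i))); rewrite /ev mevalE => fk.
  rewrite horner_sum -[RHS]fk; apply: eq_bigr => m _; rewrite hornerZ hornerXn.
  by congr (_ * _); rewrite expr_sum; apply: eq_bigr => i _; rewrite mxE mulnC exprM.
apply/mpolyP => m; rewrite mcoeff0.
have [mf|/memN_msupp_eq0 //] := boolP (m \in msupp f).
have := congr1 (fun q : {poly C} => q`_(key m)) p0; rewrite coef0 coef_sum => <-.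
rewrite (bigD1_seq m) ?msupp_uniq //= coefZ coefXn eqxx mulr1 big_seq_cond big1 ?addr0 //.
move=> m' /andP[m'f m'm]; rewrite coefZ coefXn; case: eqP => [e|_]; last by rewrite mulr0.
case/eqP: m'm; apply/mnmP => i; apply: esym; move: i.
by apply: (@digits_inj N) => [i|i|//]; exact: mN.
Qed.

End Evaluation.

(** * The ring of differential operators and its simple modules *)

(* The operations on [D(R_A)] are locked because unification on [malg] over
   [mpoly] would otherwise unfold them. *)
HB.lock Definition coefW (R : realType) (d : nat) (e : 'rV[int]_d)
  (x : @monalg.malg 'rV[int]_d (mpoly d (complex R))) := monalg.mcoeff e x.
HB.lock Definition monW (R : realType) (d : nat) (e : 'rV[int]_d)
  (f : mpoly d (complex R)) : @monalg.malg 'rV[int]_d (mpoly d (complex R)) :=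
  monalg.mkmalgU e f.
HB.lock Definition mulWl (R : realType) (d : nat)
  (P Q : @monalg.malg 'rV[int]_d (mpoly d (complex R))) := mulW P Q.

Section WeylAction.
Variables (R : realType) (d : nat) (A : seq 'rV[int]_d).
Local Notation C := (complex R).
Local Notation Weyl := (@monalg.malg 'rV[int]_d (mpoly d C)).
Local Notation Laurent := (@monalg.malg 'rV[int]_d C).
Local Notation zC := (@Defs.zC R d).
Implicit Types (P Q x : Weyl) (a b c e : 'rV[int]_d) (f g h : mpoly d C).
Implicit Types (alpha : 'rV[C]_d).

Lemma zCD a b : zC (a + b) = zC a + zC b.
Proof. by apply/rowP=> i; rewrite !mxE intrD. Qed.
Lemma zCN a : zC (- a) = - zC a.
Proof. by apply/rowP=> i; rewrite !mxE rmorphN. Qed.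
Lemma zC0 : zC 0 = 0.
Proof. by apply/rowP=> i; rewrite !mxE. Qed.

Lemma zC_sum (I : Type) (r : seq I) (P : pred I) (F : I -> 'rV[int]_d) :
  zC (\sum_(i <- r | P i) F i) = \sum_(i <- r | P i) zC (F i).
Proof. exact: (big_morph zC zCD zC0). Qed.
Lemma zCMn a n : zC (a *+ n) = n%:R *: zC a.
Proof.
by apply/rowP => i; rewrite !mxE mulmxnE rmorphMn /= mulr_natl.
Qed.

Lemma ev_lattice_eq0 f alpha : (forall z, ev f (alpha + zC z) = 0) -> f = 0.
Proof.
move=> f0; apply: ev_inj0 => v.
rewrite -(subrK alpha v) addrC [v - alpha]row_sum_delta.
apply: ev_span_eq0; first exact: index_enum_uniq.
move=> k; rewrite -(f0 (\sum_(i < d) delta_mx 0 i *+ k i)) zC_sum.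
congr (ev _ (_ + _)); apply: eq_bigr => i _; rewrite zCMn.
congr (_ *: _); apply/rowP => j; rewrite !mxE.
by case: (_ && _).
Qed.

(* [Iset a] is the ideal of polynomials [f] with [t^a f(s)] in [D(R_A)]. *)
Definition Iset a f := forall c, inNA A c -> ~ inNA A (a + c) -> ev f (zC c) = 0.

Lemma coefWP P Q : (forall e, coefW e P = coefW e Q) -> P = Q.
Proof. by rewrite coefW.unlock => E; apply/monalg.malgP. Qed.

Lemma coefWD e P Q : coefW e (P + Q) = coefW e P + coefW e Q.
Proof. by rewrite coefW.unlock; exact: monalg.mcoeffD. Qed.

Lemma coefWN e P : coefW e (- P) = - coefW e P.
Proof. by rewrite coefW.unlock; exact: monalg.mcoeffN. Qed.

Lemma coefW0 e : coefW e (0 : Weyl) = 0.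
Proof. by rewrite coefW.unlock; exact: monalg.mcoeff0. Qed.

Lemma coefW_sum e (I : Type) (r : seq I) (S : pred I) (F : I -> Weyl) :
  coefW e (\sum_(i <- r | S i) F i) = \sum_(i <- r | S i) coefW e (F i).
Proof. exact: (big_morph _ (coefWD e) (coefW0 e)). Qed.

Lemma coefW_outdom e P : e \notin monalg.msupp P -> coefW e P = 0.
Proof. by rewrite coefW.unlock; exact: monalg.mcoeff_outdom. Qed.

Lemma coef_monW a f e : coefW e (monW a f) = f *+ (a == e).
Proof. by rewrite coefW.unlock monW.unlock monalg.mcoeffU. Qed.

Lemma coef_monWE a f : coefW a (monW a f) = f.
Proof. by rewrite coef_monW eqxx mulr1n. Qed.

Lemma Weyl_sum_mon P (s : {fset 'rV[int]_d}) :
  (forall e, e \notin s -> coefW e P = 0) -> P = \sum_(e <- s) monW e (coefW e P).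
Proof.
move=> Ps; apply: coefWP => e; rewrite coefW_sum.
under eq_bigr do rewrite coef_monW.
by rewrite (big_pick (G := fun a => coefW a P)) //; exact: Ps.
Qed.

Lemma actWE P (u : Laurent) e :
  monalg.mcoeff e (actW P u) =
  \sum_(c <- monalg.msupp u) ev (coefW (e - c) P) (zC c) * monalg.mcoeff c u.
Proof.
rewrite /actW raddf_sum; under eq_bigr do rewrite raddf_sum.
rewrite exchange_big /= coefW.unlock; apply: eq_bigr => c _.
under eq_bigr => a _ do rewrite monalg.mcoeffU.
have E a : (a + c == e) = (a == e - c) by rewrite eq_sym -subr_eq eq_sym.
under eq_bigr => a _ do rewrite E.
have evE a : meval (fun i : 'I_d => (c 0 i)%:~R : C) (monalg.mcoeff a P) =
             ev (monalg.mcoeff a P) (zC c).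
  by apply: meval_eq => i; rewrite mxE.
under eq_bigr => a _ do rewrite evE.
apply: (big_pick (G := fun a => ev (monalg.mcoeff a P) (zC c) * monalg.mcoeff c u)).
  exact: fset_uniq.
by move=> /monalg.mcoeff_outdom ->; rewrite ev0 mul0r.
Qed.

Lemma coef_mulW P Q e :
  coefW e (mulWl P Q) =
  \sum_(b <- monalg.msupp Q) shiftp (coefW (e - b) P) b * coefW b Q.
Proof.
rewrite mulWl.unlock /mulW coefW_sum; under eq_bigr do rewrite coefW_sum.
rewrite exchange_big /= coefW.unlock; apply: eq_bigr => b _.
under eq_bigr => a _ do rewrite monalg.mcoeffU.
have E a : (a + b == e) = (a == e - b) by rewrite eq_sym -subr_eq eq_sym.
under eq_bigr => a _ do rewrite E.
apply: (big_pick (G := fun a => shiftp (monalg.mcoeff a P) b * monalg.mcoeff b Q)).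
  exact: fset_uniq.
by move=> /monalg.mcoeff_outdom ->; rewrite shiftp0 mul0r.
Qed.

Lemma ev_mulW P Q e v :
  ev (coefW e (mulWl P Q)) v =
  \sum_(b <- monalg.msupp Q) ev (coefW (e - b) P) (v + zC b) * ev (coefW b Q) v.
Proof.
by rewrite coef_mulW ev_sum; apply: eq_bigr => b _; rewrite evM ev_shiftp.
Qed.

Lemma mulW_mon P b f e :
  coefW e (mulWl P (monW b f)) = shiftp (coefW (e - b) P) b * f.
Proof.
rewrite coef_mulW {1}monW.unlock monalg.msuppU; case: eqP => [->|_].
  by rewrite big_seq_fset0 mulr0.
by rewrite big_seq_fset1 coef_monWE.
Qed.

Lemma mon_mulW a f Q e :
  coefW e (mulWl (monW a f) Q) = shiftp f (e - a) * coefW (e - a) Q.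
Proof.
rewrite coef_mulW.
have E b : (a == e - b) = (b == e - a).
  by rewrite eq_sym subr_eq addrC -subr_eq eq_sym.
under eq_bigr => b _ do rewrite coef_monW E.
under eq_bigr => b _.
  have -> : shiftp (f *+ (b == e - a)) b * coefW b Q =
     (shiftp f b * coefW b Q) *+ (b == e - a).
    by case: eqP => _; rewrite ?mulr1n // !mulr0n shiftp0 mul0r.
  over.
apply: (big_pick (G := fun b => shiftp f b * coefW b Q)); first exact: fset_uniq.
by move=> /coefW_outdom ->; rewrite mulr0.
Qed.

Lemma mulWlE P Q : mulWl P Q = mulW P Q.
Proof. by rewrite mulWl.unlock. Qed.

(** The summands t^a f_a(s) send t^c to different monomials, so applying [P] to a single t^c reads
    off each value f_a(c): D(R_A) is graded. *)
Lemma inDP P : inD A P <-> forall a, Iset a (coefW a P).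
Proof.
split=> [PD a c cA acA|PI u uA e].
  have ru : inRA A (monalg.mkmalgU c (1 : C)).
    move=> c'; rewrite monalg.msuppU; case: ifP => _; first by rewrite in_fset0.
    by rewrite in_fset1 => /eqP ->.
  apply: contra_notP acA => /eqP fc; apply: (PD _ ru).
  rewrite -monalg.mcoeff_neq0 actWE monalg.msuppU oner_eq0 big_seq_fset1 addrK.
  by rewrite monalg.mcoeffUU mulr1.
rewrite -monalg.mcoeff_neq0 => /eqP nz; apply: contra_notP nz => eA.
rewrite actWE big_seq big1 // => c cu.
by rewrite (PI _ c) ?mul0r ?subrK //; exact: uA.
Qed.

Lemma inD_mon a f : Iset a f -> inD A (monW a f).
Proof.
move=> If; apply/inDP => b; rewrite coef_monW; case: eqP => [<-|_] //.
by rewrite mulr0n => c _ _; rewrite ev0.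
Qed.

(** Each term starts at [c] in NA, passes through [b + c] and ends outside NA. If the intermediate
    exponent is in NA, [P] kills the term; if not, [Q] does. *)
Lemma inD_mulW P Q : inD A P -> inD A Q -> inD A (mulWl P Q).
Proof.
move=> /inDP PI /inDP QI; apply/inDP => e c cA ecA.
rewrite ev_mulW big1 // => b _; have [bcA|bcA] := EM (inNA A (b + c)).
  by rewrite -zCD [c + b]addrC PI ?mul0r // addrA subrK.
by rewrite QI ?mulr0.
Qed.

Lemma inDD P Q : inD A P -> inD A Q -> inD A (P + Q).
Proof.
move=> /inDP PI /inDP QI; apply/inDP => e c cA ecA.
by rewrite coefWD evD PI // QI // addr0.
Qed.

Lemma inD0 : inD A (0 : Weyl).
Proof. by apply/inDP => e c _ _; rewrite coefW0 ev0. Qed.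

Lemma Iset0 f : Iset 0 f.
Proof. by move=> c cA; rewrite add0r. Qed.

Lemma IsetM a f g : Iset a f -> Iset a (f * g).
Proof. by move=> If c cA acA; rewrite evM If ?mul0r. Qed.

Lemma IsetMshift a b f g : Iset a f -> Iset b g -> Iset (a + b) (shiftp f b * g).
Proof.
move=> If Ig c cA abcA; rewrite evM ev_shiftp -zCD.
have [bcA|bcA] := EM (inNA A (b + c)); last by rewrite Ig ?mulr0.
by rewrite [c + b]addrC If ?mul0r // addrA.
Qed.

(* [Up alpha b]: some [t^b h(s)] in [D(R_A)] does not vanish at [alpha]. The
   weight [alpha + b] occurs in [L(alpha)] iff [Up alpha b] and
   [Up (alpha + b) (- b)]. *)
Definition Up alpha b := exists h, Iset b h /\ ev h alpha != 0.

Lemma UpD alpha a b : Up alpha b -> Up (alpha + zC b) a -> Up alpha (a + b).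
Proof.
move=> [h [Ih h0]] [g [Ig g0]]; exists (shiftp g b * h); split.
  exact: IsetMshift.
by rewrite evM ev_shiftp mulf_neq0.
Qed.

Lemma Up0 alpha : Up alpha 0.
Proof. by exists 1; split; [exact: Iset0 | rewrite ev1 oner_eq0]. Qed.

Lemma sWE alpha i : sW alpha i = monW 0 ('X_i - (alpha 0 i)%:MP).
Proof. by rewrite monW.unlock. Qed.

(** Right multiplication by s_i - alpha_i has degree 0, so it acts on each coefficient
    separately. *)
Lemma JidP alpha x : Jid A alpha x <-> exists q : 'I_d -> Weyl,
  (forall i, inD A (q i)) /\
  forall e, coefW e x = \sum_(i < d) coefW e (q i) * ('X_i - (alpha 0 i)%:MP).
Proof.
have E q e : coefW e (\sum_(i < d) mulW (q i) (sW alpha i)) =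
    \sum_(i < d) coefW e (q i) * ('X_i - (alpha 0 i)%:MP).
  rewrite coefW_sum; apply: eq_bigr => i _.
  by rewrite sWE -mulWlE mulW_mon subr0 shiftp_id.
split=> -[q [qD xq]]; exists q; split=> //.
  by move=> e; rewrite xq E.
by apply: coefWP => e; rewrite E.
Qed.

(** The largest proper submodule of M(alpha), pulled back to D(R_A): the part of degree [e] has
    weight alpha + e, and its coefficient must vanish at [alpha] whenever that weight can be moved
    back to alpha. *)
Definition Kmax alpha x :=
  inD A x /\ forall e, Up (alpha + zC e) (- e) -> ev (coefW e x) alpha = 0.

Lemma Kmax_proper alpha : Defs.proper_sub A alpha (Kmax alpha).
Proof.
split.
- split=> [x []//|||].
  + by split=> [|e _]; rewrite ?coefW0 ?ev0 //; exact: inD0.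
  + move=> x y [xD x0] [yD y0]; split=> [|e eU]; first exact: inDD.
    by rewrite coefWD evD x0 // y0 // addr0.
  + move=> p x pD [xD x0]; rewrite -mulWlE.
    split=> [|e eU]; first exact: inD_mulW.
    rewrite ev_mulW big1 // => b _.
    (* If alpha + b has no way back to alpha, [p] cannot carry it to alpha + e, which has one: by
       [UpD] the two moves would compose to a way back. *)
    have [bU|bU] := EM (Up (alpha + zC b) (- b)); first by rewrite x0 ?mulr0.
    have [->|p0] := eqVneq (ev (coefW (e - b) p) (alpha + zC b)) 0.
      by rewrite mul0r.
    case: bU; have -> : - b = - e + (e - b) by rewrite addrA addNr add0r.
    apply: UpD; first by exists (coefW (e - b) p); split=> //; move/inDP: pD; apply.
    by rewrite -addrA -zCD [b + _]addrC subrK.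
- move=> x /JidP[q [qD xq]]; split.
    apply/inDP => e c cA ecA; rewrite xq ev_sum big1 // => i _.
    by rewrite evM; move/inDP: (qD i) => ->; rewrite ?mul0r.
  by move=> e _; rewrite xq ev_sum big1 // => i _; rewrite evM evB evXU evC subrr mulr0.
- have -> : oneW R d = monW 0 1 by rewrite monW.unlock.
  move=> [_ /(_ 0)]; rewrite oppr0 => /(_ (Up0 _)).
  by rewrite coef_monWE ev1 => /eqP; rewrite oner_eq0.
Qed.

Lemma JidD alpha x y : Jid A alpha x -> Jid A alpha y -> Jid A alpha (x + y).
Proof.
move=> /JidP[q [qD xq]] /JidP[r [rD yr]]; apply/JidP.
exists (fun i => q i + r i); split=> [i|e]; first exact: inDD.
rewrite coefWD xq yr -big_split; apply: eq_bigr => i _.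
by rewrite coefWD mulrDl.
Qed.

Lemma Jid0 alpha : Jid A alpha 0.
Proof.
apply/JidP; exists (fun=> 0); split=> [i|e]; first exact: inD0.
by rewrite coefW0 big1 // => i _; rewrite mul0r.
Qed.

Lemma Jid_mon alpha e f g : Iset e f -> ev g alpha = 0 -> Jid A alpha (monW e (f * g)).
Proof.
move=> If /ev_eq0_ideal [h gh]; apply/JidP.
exists (fun i => monW e (f * h i)); split=> [i|e'].
  by apply: inD_mon; exact: IsetM.
rewrite coef_monW; under eq_bigr do rewrite coef_monW.
case: eqP => _; last by rewrite mulr0n big1 // => i _; rewrite mulr0n mul0r.
by rewrite mulr1n gh mulr_sumr; apply: eq_bigr => i _; rewrite mulr1n mulrA.
Qed.

(** Distinct weights differ in some coordinate; each [e] contributes one linear factor in such a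
    coordinate. *)
Lemma separating_poly alpha (s : seq 'rV[int]_d) : 0 \notin s ->
  exists p : mpoly d C, ev p alpha != 0 /\ forall e, e \in s -> ev p (alpha + zC e) = 0.
Proof.
elim: s => [|e s IH]; first by exists 1; rewrite ev1 oner_eq0.
rewrite in_cons negb_or => /andP[e0 /IH[p [p0 ps]]].
have [i ei] : exists i, e 0 i != 0.
  apply/existsP; rewrite -negb_forall; apply: contra e0 => /forallP e0.
  by rewrite eq_sym; apply/eqP/rowP => i; rewrite (eqP (e0 i)) mxE.
exists (p * ('X_i - (alpha 0 i + (e 0 i)%:~R)%:MP)); split.
  rewrite evM evB evXU evC mulf_neq0 // opprD addrA subrr add0r oppr_eq0.
  by rewrite intr_eq0.
move=> e'; rewrite in_cons evM evB evXU evC => /orP[/eqP ->|/ps ->].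
  by rewrite !mxE subrr mulr0.
by rewrite mul0r.
Qed.

(* A multiple [y] of [x] has a degree 0 coefficient nonvanishing at [alpha];
   multiplying by a polynomial in [s] that kills the other weights of [y] yields
   1 modulo [Jid]. *)
Lemma sub_Kmax alpha K x : Defs.proper_sub A alpha K -> K x -> Kmax alpha x.
Proof.
move=> [[KD K0 KA KMu] JK K1] Kx.
have KM p y : inD A p -> K y -> K (mulWl p y) by rewrite mulWlE; exact: KMu.
split=> [|e [g [Ig g0]]]; first exact: KD.
apply/eqP; apply: contra_notT K1 => x0.
pose y := mulWl (monW (- e) g) x.
have Ky : K y by apply: KM => //; exact: inD_mon.
have /inDP yI := KD _ Ky.
have y0 : ev (coefW 0 y) alpha != 0.
  by rewrite mon_mulW opprK add0r evM ev_shiftp mulf_neq0.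
clearbody y; have [p [p0 ps]] : exists p : mpoly d C, ev p alpha != 0 /\
    forall e, e \in [seq e <- monalg.msupp y | e != 0] -> ev p (alpha + zC e) = 0.
  by apply: separating_poly; rewrite mem_filter eqxx.
(* The value at [alpha] of the degree 0 coefficient of p(s) y; dividing by it makes that coefficient
   1 at [alpha]. *)
pose c := ev p alpha * ev (coefW 0 y) alpha.
have c0 : c != 0 by rewrite mulf_neq0.
pose z := mulWl (monW 0 (c^-1%:MP * p)) y.
have Kz : K z by apply: KM => //; apply: inD_mon; exact: Iset0.
have zE a : coefW a z = shiftp (c^-1%:MP * p) a * coefW a y by rewrite mon_mulW subr0.
clearbody z; suff Jz : Jid A alpha (oneW R d - z).
  by have := KA _ _ (JK _ Jz) Kz; rewrite subrK.
have -> : oneW R d = monW 0 1 by rewrite monW.unlock.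
rewrite [_ - z](@Weyl_sum_mon _ (0 |` monalg.msupp y)%fset); last first.
  move=> a; rewrite in_fset1U negb_or => /andP[a0 ay].
  rewrite coefWD coefWN coef_monW eq_sym (negbTE a0) mulr0n zE.
  by rewrite coefW_outdom // mulr0 subrr.
rewrite big_seq; apply: (big_ind (Jid A alpha)) => [|*|a ay];
  [exact: Jid0|exact: JidD|].
rewrite coefWD coefWN coef_monW zE.
have [->|a0] := eqVneq a 0.
  rewrite mulr1n -[_ - _]mul1r; apply: Jid_mon; first exact: Iset0.
  rewrite evB ev1 evM ev_shiftp zC0 addr0 evM evC -mulrA.
  by rewrite mulVf // subrr.
(* The left factor is in [Iset a] because [y] lies in D(R_A); the right one vanishes at [alpha]
   because [p] vanishes at alpha + a. *)
rewrite mulr0n sub0r mulrC -mulrN.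
apply: Jid_mon; first exact: yI.
rewrite -[- _]sub0r evB ev0 ev_shiftp evM ps ?mulr0 ?subr0 //.
by rewrite mem_filter a0 /=; move: ay; rewrite in_fset1U (negbTE a0).
Qed.

Lemma NidP alpha x : Nid A alpha x <-> Kmax alpha x.
Proof.
split=> [[s [sK ->]]|xK].
  have [[_ K0 KA _] _ _] := Kmax_proper alpha.
  rewrite big_seq; apply: (big_ind (Kmax alpha)) => // y ys.
  by have [K [Kp Ky]] := sK _ ys; exact: sub_Kmax Kp Ky.
exists [:: x]; split; last by rewrite big_seq1.
move=> y yx; exists (Kmax alpha); split; first exact: Kmax_proper.
suff -> : y = x by [].
by move: yx => /predU1P[].
Qed.

(** The elements t^b h(s) with h(alpha) != 0 reach the weight alpha + b. The part of [P] of degree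
    [a] acts from there to alpha + a + b by the scalar shown, and the result survives in L(alpha)
    only if the latter weight can return to alpha. *)
Lemma annL_zeroP alpha : annL_zero A alpha <->
  forall P, inD A P ->
    (forall a b, Up alpha b -> Up (alpha + zC (a + b)) (- (a + b)) ->
       ev (coefW a P) (alpha + zC b) = 0) -> P = 0.
Proof.
split=> ann P PD Pann; apply: ann => //.
  move=> x xD; rewrite -mulWlE; apply/NidP; split; first exact: inD_mulW.
  move=> e eU; rewrite ev_mulW big1 // => b _.
  have [->|x0] := eqVneq (ev (coefW b x) alpha) 0; first by rewrite mulr0.
  rewrite Pann ?mul0r ?subrK //.
  by exists (coefW b x); split=> //; move/inDP: xD; apply.
move=> a b [h [Ih h0]] abU.
have /NidP[_ /(_ _ abU)] := Pann _ (inD_mon Ih).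
rewrite -mulWlE mulW_mon addrK evM ev_shiftp => /eqP.
by rewrite mulf_eq0 (negbTE h0) orbF => /eqP.
Qed.

End WeylAction.

(** * Farkas' lemma and facet normals *)

Section Dot.
Variables (K : comNzRingType) (d : nat).
Implicit Types (l x y : 'rV[K]_d) (c : K).

(** One pairing over any ring, convertible with [dotZ], [dotR] and [dotC], so that its lemmas serve
    all three. *)
Definition dot l x : K := \sum_(j < d) l 0 j * x 0 j.

Lemma dotC_comm l x : dot l x = dot x l.
Proof. by apply: eq_bigr => j _; rewrite mulrC. Qed.

Lemma dotDr l x y : dot l (x + y) = dot l x + dot l y.
Proof. by rewrite -big_split; apply: eq_bigr => j _; rewrite mxE mulrDr. Qed.

Lemma dotZr l c x : dot l (c *: x) = c * dot l x.
Proof. by rewrite mulr_sumr; apply: eq_bigr => j _; rewrite mxE mulrCA. Qed.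

Lemma dot0r l : dot l 0 = 0.
Proof. by rewrite -(scale0r 0) dotZr mul0r. Qed.

Lemma dotNr l x : dot l (- x) = - dot l x.
Proof. by rewrite -scaleN1r dotZr mulN1r. Qed.

Lemma dotBr l x y : dot l (x - y) = dot l x - dot l y.
Proof. by rewrite dotDr dotNr. Qed.

Lemma dotMnr l x n : dot l (x *+ n) = dot l x *+ n.
Proof. by rewrite -scaler_nat dotZr mulr_natl. Qed.

Lemma dot_sumr l (I : Type) (r : seq I) (P : pred I) (F : I -> 'rV[K]_d) :
  dot l (\sum_(i <- r | P i) F i) = \sum_(i <- r | P i) dot l (F i).
Proof. exact: (big_morph _ (dotDr l) (dot0r l)). Qed.

Lemma dotDl x y l : dot (x + y) l = dot x l + dot y l.
Proof. by rewrite !(dotC_comm _ l) dotDr. Qed.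

Lemma dotZl c x l : dot (c *: x) l = c * dot x l.
Proof. by rewrite !(dotC_comm _ l) dotZr. Qed.

Lemma dotNl x l : dot (- x) l = - dot x l.
Proof. by rewrite !(dotC_comm _ l) dotNr. Qed.

Lemma dotBl x y l : dot (x - y) l = dot x l - dot y l.
Proof. by rewrite !(dotC_comm _ l) dotBr. Qed.

Lemma dot0l l : dot 0 l = 0.
Proof. by rewrite dotC_comm dot0r. Qed.

Lemma dot_suml l (I : Type) (r : seq I) (P : pred I) (F : I -> 'rV[K]_d) :
  dot (\sum_(i <- r | P i) F i) l = \sum_(i <- r | P i) dot (F i) l.
Proof. by rewrite dotC_comm dot_sumr; apply: eq_bigr => i _; rewrite dotC_comm. Qed.

Lemma dot_delta l j : dot l (delta_mx 0 j) = l 0 j.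
Proof.
rewrite /dot (bigD1 j) //= mxE !eqxx mulr1 big1 ?addr0 // => k /negbTE kj.
by rewrite mxE kj andbF mulr0.
Qed.

End Dot.

Section Farkas.
Variables (K : realFieldType) (d : nat).
Implicit Types (s : seq 'rV[K]_d) (x y : 'rV[K]_d).

Fixpoint seq_cone s x : Prop :=
  if s is a :: s' then exists2 c, 0 <= c & seq_cone s' (x - c *: a) else x = 0.

Lemma dot_self_gt0 x : x != 0 -> 0 < dot x x.
Proof.
rewrite lt_def sumr_ge0 => [x0|i _]; last by rewrite -expr2 sqr_ge0.
rewrite andbT; apply: contra x0; rewrite psumr_eq0 => [/allP x0|i _]; last first.
  by rewrite -expr2 sqr_ge0.
apply/eqP/rowP => i; rewrite mxE; apply/eqP.
by have := x0 i (mem_index_enum i); rewrite mulf_eq0 orbb.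
Qed.

(* In the inductive step a functional separating [x] from the tail but negative
   on the head [a] is corrected by projecting everything along [a]. *)
Lemma farkas s x : ~ seq_cone s x ->
  exists y, (forall a, a \in s -> 0 <= dot y a) /\ dot y x < 0.
Proof.
have [n] := ubnP (size s); elim: n s x => // n IH [|a s] x /= sn.
  move=> /eqP x0; exists (- x); split=> //.
  by rewrite dotNl oppr_lt0 dot_self_gt0.
move=> nax; have nx : ~ seq_cone s x.
  by apply: contra_not nax => cx; exists 0 => //; rewrite scale0r subr0.
have [y [ys yx]] := IH s x sn nx.
have [ya|ya] := leP 0 (dot y a).
  by exists y; split=> // b; rewrite in_cons => /predU1P[->|/ys].
(* Projection along [a] onto the kernel of [y]. As [y] is negative on [a] and nonnegative on [s], a
   conic combination of projections is one of the original vectors plus a nonnegative multiple of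
   [a]. *)
pose pr v := v - (dot y v / dot y a) *: a.
have pr_cone t u : {subset t <= s} -> seq_cone [seq pr b | b <- t] u ->
    exists2 c, 0 <= c & seq_cone t (u - c *: a).
  elim: t u => [|b t IHt] u ts /=; first by move=> ->; exists 0; rewrite // scale0r subr0.
  move=> [c c0 /IHt[|c' c'0 tc]]; first by move=> v vt; apply: ts; rewrite in_cons vt orbT.
  have k0 : 0 <= - (dot y b / dot y a).
    rewrite -mulrN -invrN mulr_ge0 // ?ys ?ts ?mem_head // invr_ge0 oppr_ge0.
    exact: ltW.
  exists (c' - c * (dot y b / dot y a)).
    by rewrite -mulrN addr_ge0 // mulr_ge0.
  exists c => //; move: tc; congr seq_cone; apply/rowP => i; rewrite !mxE; ring.
have [] := IH [seq pr b | b <- s] (pr x); first by rewrite size_map.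
  move=> /pr_cone[//|c c0 cx]; apply: nax; exists (c + dot y x / dot y a).
    by rewrite addr_ge0 // mulr_le0 ?ltW // invr_lt0.
  by move: cx; congr seq_cone; apply/rowP => i; rewrite !mxE; ring.
move=> y' [y's y'x]; have E v : dot (y' - (dot y' a / dot y a) *: y) v = dot y' (pr v).
  by rewrite dotBl dotZl dotBr dotZr; ring.
exists (y' - (dot y' a / dot y a) *: y); split; last by rewrite E.
move=> b; rewrite E in_cons => /predU1P[->|bs]; last by apply: y's; exact: map_f.
by rewrite /pr divff ?lt_eqF // scale1r subrr dot0r.
Qed.

Lemma seq_cone_mapP (T : Type) (t0 : T) (f : T -> 'rV[K]_d) (t : seq T) x :
  seq_cone [seq f u | u <- t] x <-> exists c : 'I_(size t) -> K,
    (forall i, 0 <= c i) /\ x = \sum_i c i *: f (nth t0 t i).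
Proof.
elim: t x => [|u t IH] x /=.
  split=> [->|[c [_ ->]]]; last by rewrite big_ord0.
  by exists (fun=> 0); rewrite big_ord0.
split=> [[c c0 /IH[c' [c'0 xE]]]|[c [c0 ->]]].
  exists (fun i => if unlift ord0 i is Some j then c' j else c); split.
    by move=> i; case: unliftP.
  rewrite big_ord_recl unlift_none /= -(subrK (c *: f u) x) xE addrC.
  by congr (_ + _); apply: eq_bigr => i _; rewrite liftK.
exists (c ord0) => //; apply/IH; exists (fun i => c (lift ord0 i)); split=> //.
by rewrite big_ord_recl addrC addKr.
Qed.

(** * Extreme rays of the dual cone *)

Section Rays.
Variables (I : finType) (a : I -> 'rV[K]_d).
Hypothesis a_span : forall w, (forall i, dot w (a i) = 0) -> w = 0.

(* For [y] nonnegative on all [a i]: [y] spans an extreme ray of the dual cone. *)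
Definition ray y := forall w,
  (forall i, dot y (a i) = 0 -> dot w (a i) = 0) -> exists c, w = c *: y.

(** A functional showing that [y] is not extreme is corrected by a multiple of [y] to vanish at [x].
    It stays nonzero on some generator, and a sign makes it negative there. Moving [y] along it
    keeps the tight generators tight and the value at [x] fixed. *)
Lemma not_rayP y x : dot y x != 0 -> ~ ray y -> exists w,
  [/\ forall i, dot y (a i) = 0 -> dot w (a i) = 0, dot w x = 0
    & exists i, dot w (a i) < 0].
Proof.
move=> yx /existsNP[w /not_implyP[wy wN]].
pose w' := w - (dot w x / dot y x) *: y.
have w'0 : exists i, dot w' (a i) != 0.
  apply: contra_notP wN => /forallNP w'0; exists (dot w x / dot y x).
  apply/eqP; rewrite -subr_eq0; apply/eqP/a_span => i.
  by apply/eqP/negPn/negP/w'0.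
have w'y i : dot y (a i) = 0 -> dot w' (a i) = 0.
  by move=> yi; rewrite dotBl dotZl wy // yi mulr0 subr0.
have w'x : dot w' x = 0 by rewrite dotBl dotZl divfK // subrr.
case: w'0 => i; rewrite neq_lt => /orP[w'i|w'i]; first by exists w'; split=> //; exists i.
exists (- w'); split=> [j yj||]; first by rewrite dotNl w'y // oppr0.
  by rewrite dotNl w'x oppr0.
by exists i; rewrite dotNl oppr_lt0.
Qed.

(** Move [y] along the direction of [not_rayP] until the first further generator becomes tight; the
    smallest ratio [t] is the length of the move. The number of generators that are not tight
    drops. *)
Lemma ray_refine x y : (forall i, 0 <= dot y (a i)) -> dot y x < 0 ->
  exists y', [/\ forall i, 0 <= dot y' (a i), dot y' x < 0 & ray y'].
Proof.
have [n] := ubnP #|[set i | dot y (a i) != 0]|; elim: n y => // n IH y yn y0 yx.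
have [ry|/not_rayP] := EM (ray y); first by exists y.
move=> /(_ x); rewrite lt_eqF // => /(_ isT) [w [wy wx [i0 wi0]]].
pose t i := dot y (a i) / - dot w (a i).
case: (@arg_minP _ _ _ i0 (fun i => dot w (a i) < 0) t wi0) => i wi imin; pose y' := y + t i *: w.
have win0 : dot w (a i) != 0 by rewrite lt_eqF.
have y'i : dot y' (a i) = 0.
  by rewrite dotDl dotZl /t invrN mulrN mulNr divfK // subrr.
apply: (IH y').
- rewrite -ltnS; apply: leq_trans yn; rewrite ltnS.
  apply: proper_card; apply/properP; split.
    apply/subsetP => j; rewrite !inE; apply: contra => /eqP yj.
    by rewrite dotDl dotZl wy // yj mulr0 addr0.
  exists i; rewrite inE ?y'i ?eqxx //.
  by apply/eqP => /wy wi'; rewrite wi' ltxx in wi.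
- move=> j; rewrite dotDl dotZl; have [wj|wj] := ltP (dot w (a j)) 0.
    have := imin j wj; rewrite {2}/t ler_pdivlMr ?oppr_gt0 //.
    by rewrite mulrN -subr_ge0 opprK.
  rewrite addr_ge0 // mulr_ge0 // divr_ge0 // oppr_ge0 ltW //.
- by rewrite dotDl dotZl wx mulr0 addr0.
Qed.

End Rays.
End Farkas.

Section IntVectors.
Variables (R : realType) (d : nat).
Implicit Types (z F : 'rV[int]_d).
Local Notation zR := (@Defs.zR R d).
Local Notation zC := (@Defs.zC R d).

Lemma zRD z F : zR (z + F) = zR z + zR F.
Proof. by apply/rowP=> i; rewrite !mxE intrD. Qed.
Lemma zRN z : zR (- z) = - zR z.
Proof. by apply/rowP=> i; rewrite !mxE rmorphN. Qed.
Lemma zR0 : zR 0 = 0.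
Proof. by apply/rowP=> i; rewrite !mxE. Qed.
Lemma zR_sum (I : Type) (r : seq I) (P : pred I) (f : I -> 'rV[int]_d) :
  zR (\sum_(i <- r | P i) f i) = \sum_(i <- r | P i) zR (f i).
Proof. exact: (big_morph zR zRD zR0). Qed.
Lemma zRZ (k : int) z : zR (k *: z) = k%:~R *: zR z.
Proof. by apply/rowP=> i; rewrite !mxE intrM. Qed.
Lemma zRMn z n : zR (z *+ n) = n%:R *: zR z.
Proof. by apply/rowP => i; rewrite !mxE mulmxnE rmorphMn /= mulr_natl. Qed.
Lemma zCZ (k : int) z : zC (k *: z) = k%:~R *: zC z.
Proof. by apply/rowP=> i; rewrite !mxE intrM. Qed.
Lemma zR_inj : injective zR.
Proof. by move=> z F /rowP E; apply/rowP => i; have := E i; rewrite !mxE => /intr_inj. Qed.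
Lemma zC_inj : injective zC.
Proof. by move=> z F /rowP E; apply/rowP => i; have := E i; rewrite !mxE => /intr_inj. Qed.
Lemma dot_zR F z : dot (zR F) (zR z) = (dot F z)%:~R.
Proof. by rewrite rmorph_sum; apply: eq_bigr => j _; rewrite !mxE rmorphM. Qed.
Lemma dot_zC F z : dot (zC F) (zC z) = (dot F z)%:~R.
Proof. by rewrite rmorph_sum; apply: eq_bigr => j _; rewrite !mxE rmorphM. Qed.

End IntVectors.

(** * Rational and primitive vectors *)

Section ClearDenominators.

Lemma clear_denominators d (w : 'rV[rat]_d) : exists (z : 'rV[int]_d) (N : int),
  N != 0 /\ map_mx intr z = N%:~R *: w.
Proof.
pose N := \prod_(j < d) denq (w 0 j).
exists (\row_j (numq (w 0 j) * \prod_(k < d | k != j) denq (w 0 k))), N; split.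
  by apply/prodf_neq0 => j _; exact: denq_neq0.
apply/rowP => j; rewrite !mxE.
have -> : N = denq (w 0 j) * \prod_(k < d | k != j) denq (w 0 k) by rewrite /N (bigD1 j).
rewrite -[X in _ = _ * X]divq_num_den !rmorphM /=.
have : (denq (w 0 j))%:~R != 0 :> rat by rewrite intr_eq0 denq_neq0.
by move: (\prod_(_ | _) _)%:~R => q q0; field.
Qed.

(** Bezout: the least positive value [g] of [w] on Z^d divides every coordinate, since a nonzero
    remainder would be a smaller positive value. *)
Lemma primitive_part d (w : 'rV[int]_d) : w != 0 ->
  exists F g, [/\ 0 < g, w = g *: F & exists z, dot F z = 1].
Proof.
move=> w0; pose P (k : nat) := `[< (0 < k)%N /\ exists z, dot w z = k%:Z >].
have [j wj] : exists j, w 0 j != 0.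
  apply/existsP; rewrite -negb_forall; apply: contra w0 => /forallP w0.
  by apply/eqP/rowP => i; rewrite (eqP (w0 i)) mxE.
have exP : exists k, P k.
  exists (absz (w 0 j)); apply/asboolP; rewrite absz_gt0; split=> //.
  exists (sgz (w 0 j) *: delta_mx 0 j).
  by rewrite dotZr dot_delta abszEsg mulrC.
case: (ex_minnP exP) => g /asboolP[g0 [z zg]] gmin.
have g_dvd i : (g%:Z %| (w 0 i)%R)%Z.
  apply/dvdz_mod0P/eqP; apply: contraTT isT => r0.
  have r1 : 0 <= modz (w 0 i) g%:Z by rewrite modz_ge0 // eqz_nat -lt0n.
  have [k kE] : exists k : nat, modz (w 0 i) g%:Z = k%:Z by case: (modz _ _) r1 => // k _; exists k.
  have k0 : (0 < k)%N by rewrite lt0n -eqz_nat -kE.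
  have kg : (k < g)%N by rewrite -ltz_nat -kE ltz_pmod.
  suff Pk : P k by have := gmin k Pk; rewrite leqNgt kg.
  apply/asboolP; split=> //; exists (delta_mx 0 i - divz (w 0 i) g%:Z *: z).
  by rewrite dotBr dotZr dot_delta zg -kE /modz.
exists (\row_i divz (w 0 i) g%:Z), g%:Z; split=> //.
  by apply/rowP => i; rewrite !mxE mulrC divzK.
exists z; apply: (@mulfI _ g%:Z); first by rewrite eqz_nat -lt0n.
rewrite -dotZl mulr1 -[RHS]zg; congr (dot _ z); apply/rowP => i.
by rewrite !mxE mulrC divzK.
Qed.

End ClearDenominators.

(** * Facets and their primitive normals *)

Section Facets.
Variables (R : realType) (d : nat) (A : seq 'rV[int]_d).
Local Notation n := (size A).
Local Notation zR := (@Defs.zR R d).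
Local Notation in_cone := (@in_cone R d A).
Implicit Types (F z : 'rV[int]_d) (x y w l : 'rV[R]_d).
Implicit Types (sigma tau : 'rV[R]_d -> Prop).
Hypothesis hA : generates A.

Definition gen (i : 'I_n) := zR A`_i.

(** Generation of Z^d makes the dual cone free of lines, as [ray_refine] requires. *)
Lemma gen_span w : (forall i, dot w (gen i) = 0) -> w = 0.
Proof.
move=> w0; apply/rowP => j; rewrite mxE -dot_delta.
have [c cE] := hA (delta_mx 0 j).
have -> : delta_mx 0 j = zR (delta_mx 0 j).
  by apply/rowP => k; rewrite !mxE; case: (_ && _).
rewrite cE zR_sum dot_sumr big1 // => i _.
by rewrite zRZ dotZr [dot _ _]w0 mulr0.
Qed.

(** Primitive integral generators of the extreme rays of the dual cone; they turn out to be the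
    forms F_sigma ([facet_of_form], [facet_normalP], [facet_form_uniq]). *)
Definition facet_normal F :=
  [/\ forall i : 'I_n, 0 <= dot F A`_i, exists z, dot F z = 1 & ray gen (zR F)].

Lemma dot_gen F (i : 'I_n) : dot (zR F) (gen i) = (dot F A`_i)%:~R.
Proof. exact: dot_zR. Qed.

Lemma in_cone_gen i : in_cone (gen i).
Proof.
exists (fun j => (j == i)%:R); split; first by move=> j; rewrite ler0n.
rewrite (bigD1 i) //= eqxx scale1r big1 ?addr0 // => j /negbTE ->.
by rewrite scale0r.
Qed.

Lemma cone_ge0 l x : (forall i, 0 <= dot l (gen i)) -> in_cone x -> 0 <= dot l x.
Proof.
move=> l0 [c [c0 ->]]; rewrite dot_sumr sumr_ge0 // => i _.
by rewrite dotZr mulr_ge0 //; exact: (l0 i).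
Qed.

Lemma cone_dual x : ~ in_cone x ->
  exists y, [/\ forall i, 0 <= dot y (gen i), dot y x < 0 & ray gen y].
Proof.
move=> xN; have : ~ seq_cone [seq zR u | u <- A] x by move=> /(seq_cone_mapP 0).
move=> /farkas[y [yA yx]]; apply: (ray_refine gen_span _ yx) => i.
by apply: yA; apply/map_f/mem_nth.
Qed.

(** Generators on which [l] is nonzero become zero rows, so that extremality of a ray turns into a
    statement about rank. *)
Definition tightmx l : 'M[R]_(n, d) :=
  \matrix_i (if dot l (gen i) == 0 then gen i else 0).

Lemma tightmxP l y : y *m (tightmx l)^T = 0 <->
  forall i, dot l (gen i) = 0 -> dot y (gen i) = 0.
Proof.
have E i : (y *m (tightmx l)^T) 0 i = if dot l (gen i) == 0 then dot y (gen i) else 0.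
  rewrite mxE; case: ifP => li.
    by apply: eq_bigr => j _; rewrite [X in _ * X]mxE mxE li.
  by rewrite big1 // => j _; rewrite [X in _ * X]mxE mxE li mxE mulr0.
split=> [/rowP y0 i li|y0].
  by have := y0 i; rewrite E li eqxx mxE.
by apply/rowP => i; rewrite E mxE; case: eqP => // /y0.
Qed.

(** The line spanned by [y] is the kernel of a matrix with integer entries. Rank is unchanged by
    field extension, so this line has a nonzero rational point. *)
Lemma int_ray y : ray gen y -> y != 0 ->
  exists z (c : R), [/\ z != 0, c != 0 & zR z = c *: y].
Proof.
move=> ry y0.
pose M : 'M[rat]_(n, d) :=
  \matrix_i (if dot y (gen i) == 0 then map_mx intr A`_i else 0).
have ME : map_mx ratr M = tightmx y.
  apply/matrixP => i j; rewrite !mxE; case: ifP => _; rewrite !mxE ?ratr_int //.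
  exact: rmorph0.
have : ~~ row_free M^T.
  rewrite -(row_free_map (@ratr R)) -map_trmx ME; apply/negP => fM.
  by move: y0; rewrite -(mulmx_free_eq0 _ fM) => /eqP[]; apply/tightmxP.
rewrite -kermx_eq0 -nz_row_eq0; set w := nz_row _ => w0.
have wM : w *m M^T = 0 by apply/sub_kermxP; exact: nz_row_sub.
have [z [N [N0 zN]]] := clear_denominators w; exists z.
have zE : zR z = map_mx ratr (N%:~R *: w).
  by rewrite -zN; apply/rowP => i; rewrite !mxE ratr_int.
have z0 : zR z != 0 by rewrite zE map_mx_eq0 scaler_eq0 intr_eq0 negb_or N0.
have [|c zc] := ry (zR z).
  apply/tightmxP; rewrite -ME map_trmx zE -map_mxM -scalemxAl wM scaler0.
  by rewrite map_mx0.
exists c; split=> //; last by apply: contra z0; rewrite zc => /eqP ->; rewrite scale0r.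
by apply: contra z0 => /eqP ->; rewrite zR0.
Qed.

Lemma ray_normal y : ray gen y -> y != 0 -> (forall i, 0 <= dot y (gen i)) ->
  exists F (c : R), [/\ facet_normal F, 0 < c & y = c *: zR F].
Proof.
move=> ry y0 yA; have [z [c [z0 c0 zE]]] := int_ray ry y0.
have [F [g [g0 zF F1]]] := primitive_part z0.
have g0R : 0 < g%:~R :> R by rewrite ltr0z.
have yE : y = (c^-1 * g%:~R) *: zR F.
  by rewrite -scalerA -zRZ -zF zE scalerA mulVf // scale1r.
have k0 : c^-1 * g%:~R != 0 by rewrite mulf_neq0 ?invr_eq0 // gt_eqF.
have key F' (k : R) : 0 < k -> y = k *: zR F' -> (exists z, dot F' z = 1) ->
    facet_normal F'.
  move=> kp yF' F'1; split=> // [i|w wF'].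
    by rewrite -(ler0z R) -dot_gen -(pmulr_rge0 _ kp) -dotZl -yF'.
  have [|e ->] := ry w; last by exists (e * k); rewrite yF' scalerA.
  by move=> i yi; apply: wF'; apply: (mulfI (lt0r_neq0 kp)); rewrite -dotZl -yF' yi mulr0.
have [kp|] := ltP 0 (c^-1 * g%:~R).
  by exists F, (c^-1 * g%:~R); split=> //; apply: key yE F1.
(* The integral vector may point opposite to [y]; then [- F] is the normal. *)
rewrite le_eqVlt (negbTE k0) /= -oppr_gt0 => kn.
have yE' : y = - (c^-1 * g%:~R) *: zR (- F) by rewrite zRN scalerN scaleNr opprK.
exists (- F), (- (c^-1 * g%:~R)); split=> //; apply: key yE' _ => //.
by have [u Fu] := F1; exists (- u); rewrite dotNl dotNr opprK.
Qed.

Lemma prim_neq0 F : (exists z, dot F z = 1) -> zR F != 0.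
Proof.
move=> [z Fz]; apply/eqP => F0.
by have := dot_zR R F z; rewrite F0 dot0l Fz => /esym/eqP; rewrite oner_eq0.
Qed.

Lemma gen_gt0 l : l != 0 -> (forall i, 0 <= dot l (gen i)) ->
  exists i, 0 < dot l (gen i).
Proof.
move=> l0 lA; apply: contra_notP (elimN eqP l0) => /forallNP lN.
apply: gen_span => i; apply/eqP; rewrite eq_le lA andbT.
by rewrite leNgt; apply/negP/lN.
Qed.

(** Extremality gives F' = c F with c > 0. Both forms take the value 1, so [c] and its inverse are
    integers. *)
Lemma normal_uniq F F' : facet_normal F -> (forall i : 'I_n, 0 <= dot F' A`_i) ->
  (exists z, dot F' z = 1) -> (forall i : 'I_n, dot F A`_i = 0 -> dot F' A`_i = 0) ->
  F' = F.
Proof.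
move=> [F0 [z Fz] rF] F'0 F'1 tF; have [|c cE] := rF (zR F').
  move=> i; rewrite !dot_gen => /eqP; rewrite intr_eq0 => /eqP /tF ->.
  by [].
have F'nz := prim_neq0 F'1; have [z' F'z'] := F'1.
have c0 : 0 < c.
  have [|i] := gen_gt0 F'nz; first by move=> i; rewrite dot_gen ler0z.
  rewrite cE dotZl => ci; rewrite ltNge; apply: contraTN ci => c0.
  by rewrite -leNgt mulr_le0_ge0 // dot_gen ler0z.
have cz : (dot F' z)%:~R = c by rewrite -dot_zR cE dotZl dot_zR Fz mulr1.
have k1 : dot F' z * dot F z' = 1.
  apply: (@intr_inj R); rewrite intrM cz -dot_zR -dotZl -cE dot_zR F'z' //.
have kp : 0 < dot F' z by rewrite -(ltr0z R) cz.
have /andP[k'p _] : (0 < dot F z') && (0 < dot F z').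
  by rewrite andbb -(pmulr_rgt0 _ kp) k1.
have : dot F' z = 1 by move: k1 kp k'p; case: (dot F' z) => // -[|[|k]] //; case: (dot F z') => // -[|k'] //; lia.
by move=> k; move: cE; rewrite -cz k scale1r => /zR_inj.
Qed.

(** By [normal_uniq] a normal is determined by the set of generators on which it vanishes. *)
Lemma normals_finite : exists fs : seq 'rV[int]_d, forall F, F \in fs <-> facet_normal F.
Proof.
pose T F : {set 'I_n} := [set i : 'I_n | dot F A`_i == 0].
have /choice[g gP] : forall Z : {set 'I_n}, exists o : option 'rV[int]_d,
    if o is Some F then facet_normal F /\ T F = Z
    else forall F, facet_normal F -> T F <> Z.
  move=> Z; have [[F [FN FZ]]|noF] := EM (exists F, facet_normal F /\ T F = Z).
    by exists (Some F).
  by exists None => F FN FZ; apply: noF; exists F.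
exists (pmap g (enum {set 'I_n})) => F; rewrite mem_pmap; split.
  by move=> /mapP[Z _ gZ]; have := gP Z; rewrite -gZ => -[].
move=> FN; apply/mapP; exists (T F); first by rewrite mem_enum.
have := gP (T F); case: (g _) => [F'|/(_ F FN) //] [F'N TF]; congr Some.
have [F0 F1 _] := FN; apply: normal_uniq => // i F'i.
by move/setP: TF => /(_ i); rewrite !inE F'i eqxx => /esym/eqP.
Qed.

(** Farkas' lemma, with the separating functional refined to an extreme ray and then made
    integral. *)
Lemma cone_normals x : in_cone x <-> forall F, facet_normal F -> 0 <= dot (zR F) x.
Proof.
split=> [xc F [F0 _ _]|xF].
  by apply: cone_ge0 xc => i; rewrite dot_gen ler0z.
apply: contrapT => /cone_dual[y [yA yx ry]].
have y0 : y != 0 by apply: contraTneq yx => ->; rewrite dot0l ltxx.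
have [F [c [FN c0 yE]]] := ray_normal ry y0 yA.
by move: yx; rewrite yE dotZl pmulr_rlt0 // ltNge xF.
Qed.

Lemma rows_of_rank m (T : 'M[R]_(m, d)) k (S : 'rV[R]_d -> Prop) :
  (forall i, S (row i T)) -> \rank T = k ->
  exists M : 'M[R]_(k, d), (forall i, S (row i M)) /\ row_free M.
Proof.
move=> TS Tk; subst k; exists (rowsub (maxrankfun T) T); split.
  by move=> i; rewrite row_rowsub.
exact: maxrowsub_free.
Qed.

Definition facet_of F x := in_cone x /\ dotR (zR F) x = 0.

Lemma in_cone0 : in_cone 0.
Proof.
exists (fun=> 0); split=> //; rewrite big1 // => i _; exact: scale0r.
Qed.

(** By extremality the functionals vanishing on the generators of the facet form a line, so these
    generators have rank d - 1. *)
Lemma facet_of_facet F : facet_normal F -> is_facet A (facet_of F).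
Proof.
move=> [F0 F1 rF]; have Fnz := prim_neq0 F1.
have F0R i : 0 <= dot (zR F) (gen i) by rewrite dot_gen ler0z.
split.
- by exists (zR F); split=> // x /(cone_ge0 F0R).
- case: (posnP d) => // d0; have [z Fz] := F1.
  by move: Fz; rewrite /dot big1 // => -[j jd]; exfalso; rewrite d0 in jd.
- apply: (@rows_of_rank _ (tightmx (zR F))).
    move=> i; rewrite rowK; case: eqP => Fi; first by split=> //; exact: in_cone_gen.
    by split; [exact: in_cone0|exact: dot0r].
  have kE : \rank (kermx (tightmx (zR F))^T) = 1%N.
    apply/eqP; rewrite eqn_leq; apply/andP; split.
      apply: leq_trans (rank_leq_row (zR F)).
      apply: mxrankS; apply/row_subP => k; apply/sub_rVP/rF/tightmxP.
      by apply/sub_kermxP; exact: row_sub.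
    apply: leq_trans (_ : \rank (zR F) <= _)%N; first by rewrite rank_rV Fnz.
    by apply: mxrankS; apply/sub_kermxP/tightmxP.
  move: kE; rewrite mxrank_ker mxrank_tr; move: (rank_leq_col (tightmx (zR F))).
  by case: (\rank _) => [|r]; lia.
- move=> [M [MF fM]]; move/eqP: Fnz; apply.
  have uM : row_free M^T by rewrite row_free_unit unitmx_tr -row_free_unit.
  apply/eqP; rewrite -(mulmx_free_eq0 _ uM); apply/eqP/rowP => i.
  have [_] := MF i; rewrite mxE => Mi; rewrite !mxE -[RHS]Mi.
  by apply: eq_bigr => j _; rewrite !mxE.
Qed.

Lemma facet_of_form F : facet_normal F -> facet_form A (facet_of F) F.
Proof.
move=> FN; have [F0 [z Fz] rF] := FN; split=> [x|x []//|k].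
  by apply: cone_ge0 => i; rewrite dot_gen ler0z.
by exists (k *: z); rewrite [dotZ _ _]dotZr Fz mulr1.
Qed.

(** The d - 1 independent vectors leave at most a line of functionals vanishing on sigma, so the
    functional [l] defining sigma is an extreme ray. It is nonzero, for otherwise sigma would be the
    whole cone, which has rank d. *)
Lemma facet_normalP sigma : is_facet A sigma ->
  exists F, facet_normal F /\ forall x, sigma x <-> facet_of F x.
Proof.
move=> [[l [l0 sE]] d0 [M [Ms fM]] noM].
have l0A i : 0 <= dot l (gen i) by apply/l0/in_cone_gen.
have lnz : l != 0.
  apply/eqP => lE; apply: noM; apply: (@rows_of_rank _ (\matrix_i gen i)).
    by move=> i; rewrite rowK; apply/sE; split; [exact: in_cone_gen|rewrite lE; exact: dot0l].
  apply/eqP; rewrite -mxrank_tr -[_ == _]/(row_free _) -kermx_eq0.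
  apply/eqP/row_matrixP => k; rewrite row0; apply: gen_span => i.
  have /sub_kermxP/rowP/(_ i) := row_sub k (kermx (\matrix_i gen i)^T).
  by rewrite mxE [RHS]mxE => <-; apply: eq_bigr => j _; rewrite !mxE.
have kill w : (forall i, dot l (gen i) = 0 -> dot w (gen i) = 0) -> w *m M^T = 0.
  move=> wl; apply/rowP => k; rewrite !mxE.
  have /sE[[c [c0 Mk]] lM] := Ms k.
  have -> : \sum_j w 0 j * M^T j k = dot w (row k M).
    by apply: eq_bigr => j _; rewrite !mxE.
  move: lM; rewrite Mk [dotR _ _]dot_sumr dot_sumr.
  rewrite (eq_bigr (fun i => c i * dot l (gen i))); last by move=> i _; rewrite dotZr.
  move=> /eqP; rewrite psumr_eq0; last by move=> i _; rewrite mulr_ge0.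
  move=> /allP cl; apply: big1 => i _; rewrite dotZr.
  have := cl i (mem_index_enum i); rewrite /= mulf_eq0 => /orP[/eqP ->|/eqP /wl].
    by rewrite mul0r.
  by move=> E; rewrite -/(gen i) E mulr0.
have rl : ray gen l.
  move=> w wl; apply/sub_rVP.
  have lk : (l <= kermx M^T)%MS by apply/sub_kermxP; exact: kill.
  have : (kermx M^T <= l)%MS.
    rewrite -(mxrank_leqif_sup lk) rank_rV lnz mxrank_ker mxrank_tr.
    by move: fM; rewrite /row_free => /eqP ->; lia.
  by apply: submx_trans; apply/sub_kermxP; exact: kill.
have [F [c [FN c0 lF]]] := ray_normal rl lnz l0A.
exists F; split=> // x; rewrite sE /facet_of lF.
rewrite [dotR _ _]dotZl; split=> -[xc xl]; split=> //.
  by move/eqP: xl; rewrite mulf_eq0 gt_eqF // => /eqP.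
by rewrite [dot _ _]xl mulr0.
Qed.

(** [Fplus] and [Fminus] quantify over all forms of a facet; uniqueness reduces them to one. *)
Lemma facet_form_uniq F F' sigma : facet_normal F ->
  (forall x, sigma x <-> facet_of F x) -> facet_form A sigma F' -> F' = F.
Proof.
move=> FN sE [F'0 F's F'1]; apply: normal_uniq => //.
  by move=> i; rewrite -(ler0z R) -dot_gen; apply/F'0/in_cone_gen.
move=> i Fi; apply: (@intr_inj R); rewrite -dot_gen; apply/F's/sE.
by split; [exact: in_cone_gen|rewrite [dotR _ _]dot_gen Fi].
Qed.

Lemma facet_form_facet F sigma : facet_normal F ->
  (forall x, sigma x <-> facet_of F x) -> facet_form A sigma F.
Proof.
move=> FN sE; have [F0 Fs F1] := facet_of_form FN.
by split=> // x /sE/Fs.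
Qed.

End Facets.

(** * Affine monoids *)

(** The members of [ws] need not lie in [S]: for each one whose coset meets [S] and is not yet
    covered, a representative in [S] is picked. *)
Lemma card_mod_finite (R : realType) d (S L : 'rV[complex R]_d -> Prop)
  (ws : seq 'rV[complex R]_d) :
  (forall v w, L v -> L w -> L (v - w)) ->
  (forall v, S v -> exists2 w, w \in ws & L (v - w)) -> exists m, card_mod S L m.
Proof.
move=> LB Sws.
suff [s [sS sI sC]] : exists s : seq 'rV[complex R]_d,
    [/\ forall i, (i < size s)%N -> S s`_i,
        forall i j, (i < size s)%N -> (j < size s)%N -> L (s`_i - s`_j) -> i = j
      & forall v, S v -> (exists2 w, w \in ws & L (v - w)) ->
          exists2 i, (i < size s)%N & L (v - s`_i)].
  exists (size s), (fun i => s`_i); split=> [i|i j|v Sv]; first exact: sS.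
    by move=> /(sI _ _ (ltn_ord i) (ltn_ord j)) /val_inj.
  have [i is_ Li] := sC v Sv (Sws v Sv).
  by exists (Ordinal is_).
elim: ws {Sws} => [|w ws [s [sS sI sC]]].
  by exists [::]; split=> // v _ [].
have LN v u : L (v - u) -> L (u - v).
  by move=> Lv; have := LB _ _ (LB _ _ Lv Lv) Lv; rewrite subrr sub0r opprB.
have [[v [Sv vw vs]]|noV] := EM (exists v, [/\ S v, L (v - w) &
    forall i, (i < size s)%N -> ~ L (v - s`_i)]).
  exists (v :: s); split.
  - by case=> [|i] //=; rewrite ltnS; exact: sS.
  - case=> [|i] [|j] //=; rewrite ?ltnS => is_ js.
    + by move=> Lv; case: (vs _ js Lv).
    + by move=> /LN Lv; case: (vs _ is_ Lv).
    + by move=> /(sI _ _ is_ js) ->.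
  - move=> u Su [w']; rewrite in_cons => /predU1P[->|w's] uw.
      by exists 0%N => //=; have := LB _ _ uw vw; rewrite opprB addrA subrK.
    by have [|i is_ Li] := sC u Su; [exists w'|exists i.+1].
exists s; split=> // u Su [w']; rewrite in_cons => /predU1P[->|w's] uw; last first.
  by apply: sC => //; exists w'.
apply: contra_notP noV => /forall2NP noU; exists u; split=> // i is_.
by case: (noU i) => // /(_ is_).
Qed.

Section Monoids.
Variables (R : realType) (d : nat) (A : seq 'rV[int]_d).
Local Notation C := (complex R).
Local Notation n := (size A).
Local Notation zR := (@Defs.zR R d).
Local Notation zC := (@Defs.zC R d).
Local Notation gen := (@gen R d A).
Implicit Types (z u w : 'rV[int]_d) (B : pred 'I_n).

(** The index set [B] stands for the generators on a face. [NB] and [ZB] stay inside Z^d, whereas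
    the spans of the statement live in C^d. *)
Definition NB B z := exists c : 'I_n -> nat, z = \sum_(i | B i) A`_i *+ c i.
Definition ZB B z := exists c : 'I_n -> int, z = \sum_(i | B i) c i *: A`_i.
Definition RB B (x : 'rV[R]_d) := exists c : 'I_n -> R, x = \sum_(i | B i) c i *: gen i.
Definition CB B (v : 'rV[C]_d) := exists c : 'I_n -> C, v = \sum_(i | B i) c i *: zC A`_i.

Lemma scale_posz z (k : nat) : k%:Z *: z = z *+ k.
Proof. by rewrite -natz scaler_nat. Qed.

Lemma NB_ZB B z : NB B z -> ZB B z.
Proof.
by move=> [c ->]; exists (fun i => (c i)%:Z); apply: eq_bigr => i _; rewrite scale_posz.
Qed.

Lemma NB0 B : NB B 0.
Proof. by exists (fun=> 0%N); rewrite big1. Qed.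

Lemma NBD B z w : NB B z -> NB B w -> NB B (z + w).
Proof.
move=> [c ->] [e ->]; exists (fun i => c i + e i)%N.
by rewrite -big_split; apply: eq_bigr => i _; rewrite mulrnDr.
Qed.

Lemma NBMn B z k : NB B z -> NB B (z *+ k).
Proof.
by move=> zB; elim: k => [|k IH]; [exact: NB0|rewrite mulrS; exact: NBD].
Qed.

Lemma NB_sum B (e : 'I_n -> nat) : NB B (\sum_(i | B i) A`_i *+ e i).
Proof. by exists e. Qed.

Lemma NB_inNA B z : NB B z -> inNA A z.
Proof.
move=> [c ->]; exists (fun i => if B i then c i else 0%N).
by rewrite big_mkcond; apply: eq_bigr => i _; case: (B i).
Qed.

Lemma inNAP z : inNA A z <-> NB xpredT z.
Proof. by split=> -[c ->]; exists c. Qed.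

Lemma inNAD z w : inNA A z -> inNA A w -> inNA A (z + w).
Proof. by move=> /inNAP zA /inNAP wA; apply/inNAP; exact: NBD. Qed.

Lemma ZBB B z w : ZB B z -> ZB B w -> ZB B (z - w).
Proof.
move=> [c ->] [e ->]; exists (fun i => c i - e i).
by rewrite -sumrB; apply: eq_bigr => i _; rewrite scalerBl.
Qed.

Lemma ZB0 B : ZB B 0. Proof. exact/NB_ZB/NB0. Qed.

Lemma ZBN B z : ZB B z -> ZB B (- z).
Proof. by rewrite -sub0r; apply: ZBB; exact: ZB0. Qed.

Lemma ZBD B z w : ZB B z -> ZB B w -> ZB B (z + w).
Proof. by move=> zB /ZBN; rewrite -[in ZB B (z + w)](opprK w); exact: ZBB. Qed.

Lemma ZB_NB_add B z : ZB B z -> exists2 u, NB B u & NB B (z + u).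
Proof.
move=> [c ->]; exists (\sum_(i | B i) A`_i *+ absz (c i)); first by exists (fun i => absz (c i)).
exists (fun i => absz (c i + `|c i|)); rewrite -big_split; apply: eq_bigr => i _ /=.
by rewrite -!scale_posz -scalerDl; congr (_ *: _); lia.
Qed.

Lemma finite_box (K : nat) : exists ws : seq 'rV[int]_d,
  forall z, (forall j, `|z 0 j| <= K%:Z) -> z \in ws.
Proof.
pose f (g : {ffun 'I_d -> 'I_(K + K).+1}) : 'rV[int]_d := \row_j ((g j : nat)%:Z - K%:Z).
exists [seq f g | g <- enum {ffun 'I_d -> 'I_(K + K).+1}] => z zK.
apply/mapP; exists [ffun j => inord (absz (z 0 j + K%:Z))]; first by rewrite mem_enum.
apply/rowP => j; rewrite mxE ffunE; have := zK j; rewrite ler_norml.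
by move: (z 0 j) => t /andP[h1 h2]; rewrite inordK; lia.
Qed.

(** Coefficients in [0, 1) bound every coordinate by the sum of the absolute values of all entries
    of [A]: a parallelepiped holds finitely many integral points. *)
Lemma finite_frac B : exists ws : seq 'rV[int]_d, forall (r : 'I_n -> R) z,
  (forall i, 0 <= r i < 1) -> zR z = \sum_(i | B i) r i *: gen i -> z \in ws.
Proof.
pose K := (\sum_(j < d) \sum_(i < n) absz (A`_i 0 j)%R)%N.
have [ws wsP] := finite_box K; exists ws => r z r01 zE; apply: wsP => j.
rewrite -(ler_int R) -abszE -[X in X <= _]/((absz (z 0 j))%:~R).
have -> : (absz (z 0 j))%:~R = `|zR z 0 j| :> R by rewrite mxE intr_norm.
rewrite zE summxE; apply: le_trans (ler_norm_sum _ _ _) _.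
apply: le_trans (_ : (\sum_(i < n) absz (A`_i 0 j))%:~R <= _); last first.
  by rewrite ler_int lez_nat /K (bigD1 j) //= leq_addr.
rewrite (big_morph _ PoszD (erefl 0%:Z)) rmorph_sum big_mkcond /=.
apply: ler_sum => i _; have /andP[ri0 ri1] := r01 i.
have -> : (absz (A`_i 0 j))%:~R = `|(A`_i 0 j)%:~R| :> R by rewrite -intr_norm.
case: (B i) => //; rewrite !mxE normrM (ger0_norm ri0).
by rewrite ler_piMl // ltW.
Qed.

Lemma floor_split (c : R) : exists (k : int) (r : R), 0 <= r < 1 /\ c = k%:~R + r.
Proof.
exists (Num.floor c), (c - (Num.floor c)%:~R); split; last by rewrite addrC subrK.
by have := floor_itv c; rewrite intrD => /andP[h1 h2]; rewrite subr_ge0 h1 ltrBlDl.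
Qed.

Lemma split_frac B (c : 'I_n -> R) z : zR z = \sum_(i | B i) c i *: gen i ->
  exists (k : 'I_n -> int) (r : 'I_n -> R),
    [/\ forall i, 0 <= r i < 1, forall i, c i = (k i)%:~R + r i
     & zR (z - \sum_(i | B i) k i *: A`_i) = \sum_(i | B i) r i *: gen i].
Proof.
have /choice[k /choice[r krP]] := fun i => floor_split (c i).
move=> zE; exists k, r; split=> [i|i|]; [by case: (krP i)|by case: (krP i)|].
rewrite zRD zRN zE zR_sum -sumrB; apply: eq_bigr => i _.
have [_ ->] := krP i; by rewrite scalerDl zRZ addrAC subrr add0r.
Qed.

(* Finitely many fractional parts occur, and each one lying in the group can be
   pushed into the monoid by adding an element of the monoid. *)
Lemma conductor B : exists2 u, NB B u & forall z (c : 'I_n -> R), ZB B z ->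
  (forall i, 0 <= c i) -> zR z = zR u + \sum_(i | B i) c i *: gen i -> NB B z.
Proof.
have [ws wsP] := finite_frac B.
have [u uB uP] : exists2 u, NB B u & forall w, w \in ws -> ZB B w -> NB B (w + u).
  elim: ws {wsP} => [|w ws [u uB uP]]; first by exists 0; first exact: NB0.
  have [wB|wB] := EM (ZB B w); last first.
    by exists u => // w'; rewrite in_cons => /predU1P[->|/uP].
  have [v vB wvB] := ZB_NB_add wB; exists (u + v); first exact: NBD.
  move=> w'; rewrite in_cons => /predU1P[->|w'ws] w'B.
    by rewrite [u + v]addrC addrA; exact: NBD.
  by rewrite addrA; apply: NBD => //; exact: uP.
exists u => // z c zB c0 zE.
have [|k [r [r01 ckr wE]]] := @split_frac B c (z - u).
  by rewrite zRD zRN zE addrC addKr.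
set w := z - u - _ in wE.
have wB : NB B (w + u).
  apply: uP; first exact: wsP wE.
  apply: ZBB; last by exists k.
  by apply: ZBB => //; exact: NB_ZB.
have -> : z = (w + u) + \sum_(i | B i) A`_i *+ absz (k i).
  have -> : w + u = z - \sum_(i | B i) k i *: A`_i by rewrite /w addrAC subrK.
  rewrite -[LHS](subrK (\sum_(i | B i) k i *: A`_i)); congr (_ + _).
  apply: eq_bigr => i _; have k0 : 0 <= k i.
    have : - 1 < (k i)%:~R :> R.
      have /andP[_ r1] := r01 i; have := c0 i; rewrite ckr; lra.
    by rewrite -(intrN _ 1) ltr_int; lia.
  by rewrite -scale_posz gez0_abs.
by apply: NBD => //; exact: NB_sum.
Qed.

Lemma finite_index B : exists ws : seq 'rV[int]_d, forall z, RB B (zR z) ->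
  exists2 w, w \in ws & ZB B (z - w).
Proof.
have [ws wsP] := finite_frac B; exists ws => z [c /split_frac[k [r [r01 _ wE]]]].
exists (z - \sum_(i | B i) k i *: A`_i); first exact: wsP wE.
by rewrite opprB addrC subrK; exists k.
Qed.

(** A linear system with rational data that is solvable over C is solvable over Q. *)
Lemma CB_rat B z : CB B (zC z) -> exists q : 'I_n -> rat,
  map_mx intr z = \sum_(i | B i) q i *: map_mx intr A`_i :> 'rV[rat]_d.
Proof.
move=> [c zE]; pose M : 'M[rat]_(n, d) := \matrix_i (if B i then map_mx intr A`_i else 0).
have zM : map_mx ratr (map_mx intr z : 'rV[rat]_d) = zC z.
  by apply/rowP => j; rewrite !mxE ratr_int.
have : (map_mx (@ratr C) (map_mx intr z) <= map_mx (@ratr C) M)%MS.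
  rewrite zM; apply/submxP; exists (\row_i c i); rewrite zE.
  apply/rowP => j; rewrite mxE summxE big_mkcond; apply: eq_bigr => i _.
  by rewrite !mxE; case: (B i); rewrite !mxE ?ratr_int // rmorph0 mulr0.
rewrite map_submx => /submxP[D zD]; exists (fun i => D 0 i).
rewrite zD; apply/rowP => j; rewrite mxE summxE [RHS]big_mkcond; apply: eq_bigr => i _.
by rewrite [M _ _]mxE; case: (B i); rewrite !mxE ?mulr0.
Qed.

Lemma CB_RB B z : CB B (zC z) -> RB B (zR z).
Proof.
move=> /CB_rat[q zq]; exists (fun i => ratr (q i)).
have -> : zR z = map_mx ratr (map_mx intr z : 'rV[rat]_d).
  by apply/rowP => j; rewrite !mxE ratr_int.
rewrite zq; apply/rowP => j; rewrite mxE !summxE rmorph_sum; apply: eq_bigr => i _.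
by rewrite !mxE rmorphM /= ratr_int.
Qed.

Lemma CBB B (v w : 'rV[C]_d) : CB B v -> CB B w -> CB B (v - w).
Proof.
move=> [c ->] [e ->]; exists (fun i => c i - e i).
by rewrite -sumrB; apply: eq_bigr => i _; rewrite scalerBl.
Qed.

Lemma CB0 B : CB B 0.
Proof. by exists (fun=> 0); rewrite big1 // => i _; rewrite scale0r. Qed.

Lemma CBD B (v w : 'rV[C]_d) : CB B v -> CB B w -> CB B (v + w).
Proof.
move=> vB wB; rewrite -(opprK w) -[- w]sub0r.
by apply: CBB => //; apply: CBB => //; exact: CB0.
Qed.

Lemma ZB_CB B z : ZB B z -> CB B (zC z).
Proof.
move=> [c ->]; exists (fun i => (c i)%:~R); rewrite zC_sum.
by apply: eq_bigr => i _; rewrite zCZ.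
Qed.

(** * The spans and E_tau of the statement in terms of index sets *)

Section Bridge.
Variables (tau : 'rV[R]_d -> Prop) (B : pred 'I_n).
Hypothesis tauB : forall i, tau (gen i) <-> B i.

Lemma big_supp (K : nzRingType) (V : lmodType K) (c : 'I_n -> K) (f : 'I_n -> V) :
  (forall i, c i != 0 -> tau (gen i)) ->
  \sum_(i < n) c i *: f i = \sum_(i | B i) c i *: f i.
Proof.
move=> cB; rewrite [RHS]big_mkcond; apply: eq_bigr => i _; case: ifP => // Bi.
have [->|/cB/tauB] := eqVneq (c i) 0; first by rewrite scale0r.
by rewrite Bi.
Qed.

Lemma big_supp_if (K : nzRingType) (V : lmodType K) (c : 'I_n -> K) (f : 'I_n -> V) :
  exists e : 'I_n -> K, (forall i, e i != 0 -> tau (gen i)) /\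
    \sum_(i | B i) c i *: f i = \sum_(i < n) e i *: f i.
Proof.
have eB i : (if B i then c i else 0) != 0 -> tau (gen i).
  by case: ifP => [/tauB|]; rewrite ?eqxx.
exists (fun i => if B i then c i else 0); split=> //.
by rewrite big_supp //; apply: eq_bigr => i ->.
Qed.

Lemma spanCP v : spanC A tau v <-> CB B v.
Proof.
split=> [[c [cB ->]]|[c ->]]; first by exists c; rewrite big_supp.
by have [e [eB ->]] := big_supp_if c (fun i : 'I_n => zC A`_i); exists e.
Qed.

Lemma spanZP v : spanZ A tau v <-> exists2 z, ZB B z & v = zC z.
Proof.
have E (c : 'I_n -> int) : zC (\sum_(i < n) c i *: A`_i) = \sum_(i < n) (c i)%:~R *: zC A`_i.
  by rewrite zC_sum; apply: eq_bigr => i _; rewrite zCZ.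
split=> [[c [cB ->]]|[z [c ->] ->]].
  by exists (\sum_(i < n) c i *: A`_i); [exists c; rewrite big_supp|rewrite E].
have [e [eB ->]] := big_supp_if c (fun i : 'I_n => A`_i).
by exists e; split=> //; rewrite E.
Qed.

Lemma spanQZP v : spanQZ A tau v <-> exists2 z, CB B (zC z) & v = zC z.
Proof.
split=> [[[z ->] [q [qB zE]]]|[z zB ->]].
  exists z => //; apply/spanCP; exists (fun i => ratr (q i)); split=> // i.
  by rewrite fmorph_eq0; exact: qB.
split; first by exists z.
have [q zq] := CB_rat zB.
have [e [eB eE]] := big_supp_if q (fun i : 'I_n => map_mx intr A`_i : 'rV[rat]_d).
exists e; split=> //; have -> : zC z = map_mx ratr (map_mx intr z : 'rV[rat]_d).
  by apply/rowP => j; rewrite !mxE ratr_int.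
rewrite zq eE; apply/rowP => j; rewrite mxE !summxE rmorph_sum; apply: eq_bigr => i _.
by rewrite !mxE rmorphM /= ratr_int.
Qed.

Lemma inEP alpha v : Defs.inE A tau alpha v <->
  CB B v /\ exists x y, [/\ inNA A x, ZB B y & alpha - v = zC (x + y)].
Proof.
split=> [[/spanCP vB [_ [_ [[x [xA ->]] /spanZP[y yB ->] vE]]]]|[vB [x [y [xA yB vE]]]]].
  by split=> //; exists x, y; rewrite zCD.
split; first exact/spanCP.
by exists (zC x), (zC y); rewrite -zCD; split=> //; [exists x|apply/spanZP; exists y].
Qed.

Lemma card_spanQZ : exists m, card_mod (spanQZ A tau) (spanZ A tau) m.
Proof.
have [ws wsP] := finite_index B.
apply: (@card_mod_finite _ _ _ _ [seq zC w | w <- ws]).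
  move=> _ _ /spanZP[z zB ->] /spanZP[w wB ->]; apply/spanZP.
  by exists (z - w); [exact: ZBB|rewrite zCD zCN].
move=> _ /spanQZP[z /CB_RB /wsP[w wws zwB] ->].
exists (zC w); first exact: map_f.
by apply/spanZP; exists (z - w) => //; rewrite zCD zCN.
Qed.

(** Modulo Z(A \cap tau), the [v] with alpha - v integral form, if there are any, a torsor under the
    finite group of [spanQZ] modulo [spanZ], and E_tau(alpha) is a part of it. By finiteness, having
    as many elements as the group means being the whole torsor. *)
Lemma EfullP alpha : Efull A tau alpha <->
  (exists2 v, CB B v & exists z, alpha - v = zC z) /\
  forall v z, CB B v -> alpha - v = zC z -> Defs.inE A tau alpha v.
Proof.
split.
  move=> [m [[s [sE sI sC]] [t [tQ tI tC]]]].
  have [k0 _] : exists k, spanZ A tau (0 - t k).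
    by apply: tC; apply/spanQZP; exists 0; rewrite zC0 //; exact: CB0.
  have sB k : CB B (s k) /\ exists z, alpha - s k = zC z.
    by have /inEP[sB [x [y [_ _ ->]]]] := sE k; split=> //; exists (x + y).
  split; first by have [? ?] := sB k0; exists (s k0).
  move=> v z vB vz.
  have sv k : exists2 w, CB B (zC w) & s k - v = zC w.
    have [skB [w wE]] := sB k; have vsE : s k - v = zC (z - w).
      by rewrite zCD zCN -vz -wE opprB [RHS]addrC addrA subrK.
    by exists (z - w); rewrite // -vsE; exact: CBB.
  have /choice[f fP] : forall k, exists j, spanZ A tau (s k - v - t j).
    by move=> k; apply: tC; apply/spanQZP; exact: sv.
  have f_inj : injective f.
    move=> k k' fk; apply: sI; have := fP k'; rewrite -fk.
    move: (fP k) => /spanZP[x xB xE] /spanZP[y yB yE].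
    apply/spanZP; exists (x - y); first exact: ZBB.
    by rewrite zCD zCN -xE -yE opprB addrA subrK opprB addrA subrK.
  have [j0 j0P] : exists j, spanZ A tau (0 - t j).
    by apply: tC; apply/spanQZP; exists 0; rewrite zC0 //; exact: CB0.
  (* An injective self-map of a finite set is onto, so some [s k - v] lies in the class of [t j0],
     the trivial one. *)
  have [g _ gK] := injF_bij f_inj.
  have := fP (g j0); rewrite gK => /spanZP[x xB xE].
  move: j0P => /spanZP[y yB yE].
  have svE : s (g j0) - v = zC (x - y).
    by rewrite zCD zCN -xE -yE sub0r opprK subrK.
  have /inEP[_ [p [q [pA qB pq]]]] := sE (g j0).
  apply/inEP; split=> //; exists p, (q + (x - y)); split=> //.
    by apply: ZBD => //; exact: ZBB.
  by rewrite addrA zCD -pq -svE addrA subrK.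
move=> [[v0 v0B [z0 z0E]] full]; have [m mQ] := card_spanQZ.
exists m; split=> //; have [t [tQ tI tC]] := mQ.
exists (fun k => v0 + t k); split=> [k|k k'|v /inEP[vB [x [y [_ _ vE]]]]].
- have /spanQZP[z zB tE] := tQ k.
  by apply: (full _ (z0 - z)); [rewrite tE; exact: CBD|rewrite zCD zCN -z0E tE opprD addrA].
- by rewrite opprD addrACA subrr add0r; exact: tI.
have [|k kP] := tC (v - v0); last by exists k; rewrite opprD addrA.
have E : v - v0 = zC (z0 - (x + y)).
  by rewrite [RHS]zCD zCN -z0E -vE opprB [RHS]addrC addrA subrK.
by apply/spanQZP; exists (z0 - (x + y)); rewrite // -E; exact: CBB.
Qed.

End Bridge.
End Monoids.

(** * Faces *)

(** Merges the thresholds of finitely many facets, cosets or sets of facets into one. *)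
Lemma uniform_bound (T : eqType) (s : seq T) (P : T -> nat -> Prop) :
  (forall t M N, (M <= N)%N -> P t M -> P t N) ->
  (forall t, t \in s -> exists N, P t N) -> exists N, forall t, t \in s -> P t N.
Proof.
move=> Pm; elim: s => [|t s IH] Ps; first by exists 0%N.
have [|N NP] := IH; first by move=> u us; apply: Ps; rewrite in_cons us orbT.
have [|M MP] := Ps t; first exact: mem_head.
exists (M + N)%N => u; rewrite in_cons => /predU1P[->|/NP].
  by apply: Pm MP; exact: leq_addr.
by apply: Pm; exact: leq_addl.
Qed.

Lemma real_bound (R : realType) (x : R) : exists N : nat, x <= N%:R.
Proof.
exists (Num.bound `|x|); apply: le_trans (ler_norm x) _.
by rewrite ltW // archi_boundP.
Qed.

(** * Real and imaginary parts of complex points *)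

Section RealPart.
Variables (R : realType) (d : nat).
Local Notation C := (complex R).
Local Notation zR := (@Defs.zR R d).
Local Notation zC := (@Defs.zC R d).

Lemma int_complex (k : int) : (k%:~R : C) = Complex k%:~R 0.
Proof. by rewrite -(rmorph_int (real_complex R)). Qed.

Lemma Re_mulz (a : C) (k : int) : complex.Re (a * k%:~R) = complex.Re a * k%:~R.
Proof. by case: a => a b; rewrite int_complex /= mulr0 subr0. Qed.

Lemma Im_mulz (a : C) (k : int) : complex.Im (a * k%:~R) = complex.Im a * k%:~R.
Proof. by case: a => a b; rewrite int_complex /= mulr0 add0r. Qed.

Lemma Re_sum (I : Type) (r : seq I) (P : pred I) (f : I -> C) :
  complex.Re (\sum_(i <- r | P i) f i) = \sum_(i <- r | P i) complex.Re (f i).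
Proof. by apply: big_morph => // -[? ?] []. Qed.

Lemma Im_sum (I : Type) (r : seq I) (P : pred I) (f : I -> C) :
  complex.Im (\sum_(i <- r | P i) f i) = \sum_(i <- r | P i) complex.Im (f i).
Proof. by apply: big_morph => // -[? ?] []. Qed.

Lemma Re_dot (F : 'rV[int]_d) (v : 'rV[C]_d) :
  complex.Re (dot (zC F) v) = dot (zR F) (map_mx (@complex.Re R) v).
Proof.
rewrite dotC_comm Re_sum dotC_comm; apply: eq_bigr => j _.
by rewrite !mxE Re_mulz.
Qed.

Lemma Im_dot (F : 'rV[int]_d) (v : 'rV[C]_d) :
  complex.Im (dot (zC F) v) = dot (zR F) (map_mx (@complex.Im R) v).
Proof.
rewrite dotC_comm Im_sum dotC_comm; apply: eq_bigr => j _.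
by rewrite !mxE Im_mulz.
Qed.

End RealPart.

Section Faces.
Variables (R : realType) (d : nat) (A : seq 'rV[int]_d).
Local Notation C := (complex R).
Local Notation n := (size A).
Local Notation zR := (@Defs.zR R d).
Local Notation zC := (@Defs.zC R d).
Local Notation gen := (@gen R d A).
Local Notation in_cone := (@in_cone R d A).
Local Notation facet_normal := (@facet_normal R d A).
Local Notation RB := (@RB R d A).
Local Notation CB := (@CB R d A).
Local Notation NB := (@NB d A).
Local Notation ZB := (@ZB d A).
Local Notation inNA := (@inNA d A).
Implicit Types (F z u : 'rV[int]_d) (x w : 'rV[R]_d) (alpha v : 'rV[C]_d).
Implicit Types (B : pred 'I_n) (tau sigma : 'rV[R]_d -> Prop).
Hypothesis hA : generates A.

(** For a normal [F]: the facet of [F] contains all generators in [B]. *)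
Definition vanish_on B F := [forall i : 'I_n, B i ==> (dot F A`_i == 0)].

Lemma vanish_onP B F : reflect (forall i, B i -> dot F A`_i = 0) (vanish_on B F).
Proof.
apply: (iffP forallP) => [h i Bi|h i]; first by have := h i; rewrite Bi => /eqP.
by apply/implyP => /h /eqP.
Qed.

Lemma dot_NB_ge0 F B z : facet_normal F -> NB B z -> 0 <= dot F z.
Proof.
move=> [F0 _ _] [c ->]; rewrite dot_sumr sumr_ge0 // => i _.
by rewrite dotMnr mulrn_wge0.
Qed.

Lemma dot_NA_ge0 F z : facet_normal F -> inNA z -> 0 <= dot F z.
Proof. by move=> FN /inNAP; exact: dot_NB_ge0. Qed.

Lemma dot_RB F B x : vanish_on B F -> RB B x -> dot (zR F) x = 0.
Proof.
move=> /vanish_onP FB [c ->]; rewrite dot_sumr big1 // => i Bi.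
by rewrite dotZr dot_gen FB // mulr0.
Qed.

Lemma dot_CB F B v : vanish_on B F -> CB B v -> dot (zC F) v = 0.
Proof.
move=> /vanish_onP FB [c ->]; rewrite dot_sumr big1 // => i Bi.
by rewrite dotZr dot_zC FB // mulr0.
Qed.

Lemma dot_ZB F B z : vanish_on B F -> ZB B z -> dot F z = 0.
Proof.
move=> /vanish_onP FB [c ->]; rewrite dot_sumr big1 // => i Bi.
by rewrite dotZr FB // mulr0.
Qed.

Lemma RBB B x w : RB B x -> RB B w -> RB B (x - w).
Proof.
move=> [c ->] [e ->]; exists (fun i => c i - e i).
by rewrite -sumrB; apply: eq_bigr => i _; rewrite scalerBl.
Qed.

Definition interior_pt B : 'rV[int]_d := \sum_(i | B i) A`_i.

Lemma interior_NB B : NB B (interior_pt B).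
Proof. by exists (fun=> 1%N); apply: eq_bigr => i _; rewrite mulr1n. Qed.

Lemma interior_vanish B F : vanish_on B F -> dot F (interior_pt B) = 0.
Proof. by move=> FB; apply: dot_ZB FB _; apply/NB_ZB/interior_NB. Qed.

Lemma interior_pos B F : facet_normal F -> ~~ vanish_on B F -> 1 <= dot F (interior_pt B).
Proof.
move=> FN /vanish_onP oN; have [i Bi Fi] : exists2 i : 'I_n, B i & dot F A`_i != 0.
  apply: contra_notP oN => /forall2NP h i Bi; apply/eqP.
  by case: (h i) => // /negP; rewrite negbK.
have [F0 _ _] := FN; rewrite /interior_pt (bigD1 i) //= dotDr.
have : 0 <= dot F (\sum_(j | B j && (j != i)) A`_j).
  by rewrite dot_sumr sumr_ge0.
have key (a b : int) : a != 0 -> 0 <= a -> 0 <= b -> 1 <= a + b by lia.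
by apply: key.
Qed.

Lemma NB_RB B z : NB B z -> RB B (zR z).
Proof.
move=> [c ->]; exists (fun i => (c i)%:R); rewrite zR_sum.
by apply: eq_bigr => i _; rewrite zRMn.
Qed.

(** A large multiple of [interior_pt B] repairs the inequalities of the facets that do not contain
    [B] and leaves the other values unchanged. *)
Lemma face_lift B x : (forall F, facet_normal F -> vanish_on B F -> 0 <= dot (zR F) x) ->
  exists M : nat, in_cone (x + zR (interior_pt B *+ M)).
Proof.
move=> x0; have [fs fsP] := normals_finite R hA.
have [M MP] : exists M : nat, forall F, F \in fs -> - dot (zR F) x <= M%:R.
  apply: uniform_bound => [F M N MN h|F _]; last exact: real_bound.
  by apply: le_trans h _; rewrite ler_nat.
exists M; apply/(cone_normals hA) => F FN; rewrite dotDr zRMn dotZr dot_zR.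
have [FB|FB] := boolP (vanish_on B F).
  by rewrite interior_vanish // mulr0 addr0 x0.
have := MP F; rewrite (iffRL (fsP F)) // => /(_ isT) Mx.
have : M%:R * 1 <= M%:R * (dot F (interior_pt B))%:~R :> R.
  by rewrite ler_wpM2l // ler1z interior_pos.
lra.
Qed.

Section Functional.
Variable l : 'rV[R]_d.
Hypothesis l_ge0 : forall i, 0 <= dot l (gen i).
Definition face_idx : pred 'I_n := fun i => dot l (gen i) == 0.
Local Notation B := face_idx.

Lemma cone_RB x : in_cone x -> dot l x = 0 ->
  exists c : 'I_n -> R, (forall i, 0 <= c i) /\ x = \sum_(i | B i) c i *: gen i.
Proof.
move=> [c [c0 xE]]; rewrite xE dot_sumr => /eqP.
rewrite psumr_eq0; last by move=> i _; rewrite dotZr mulr_ge0 //; exact: l_ge0.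
move=> /allP cl; exists c; split=> //; rewrite [RHS]big_mkcond.
apply: eq_bigr => i _; case: ifP => // Bi.
have := cl i (mem_index_enum i); rewrite /= dotZr mulf_eq0 => /orP[/eqP ->|].
  by rewrite scale0r.
by rewrite -/(gen i) -/(B i) Bi.
Qed.

Lemma dot_face_RB x : RB B x -> dot l x = 0.
Proof.
move=> [c ->]; rewrite dot_sumr big1 // => i /eqP Bi.
by rewrite dotZr Bi mulr0.
Qed.

(** Lifting [- x] into the cone by a multiple of [interior_pt B], on which [l] vanishes, gives l(x)
    <= 0: a face is the intersection of the facets containing it. *)
Lemma face_of_normals x : in_cone x ->
  (forall F, facet_normal F -> vanish_on B F -> dot (zR F) x = 0) -> dot l x = 0.
Proof.
move=> xc xF; have [|M Mc] := @face_lift B (- x).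
  by move=> F FN FB; rewrite dotNr xF // oppr0.
have := cone_ge0 l_ge0 Mc; rewrite dotDr dotNr.
rewrite (dot_face_RB (NB_RB (NBMn _ (interior_NB _)))) addr0 oppr_ge0 => lx.
by apply/eqP; rewrite eq_le lx (cone_ge0 l_ge0 xc).
Qed.

(** Adding a multiple of [interior_pt B] lifts [x] into the cone while the forms of the facets
    containing the face stay zero, hence into the face. *)
Lemma face_span x : (forall F, facet_normal F -> vanish_on B F -> dot (zR F) x = 0) -> RB B x.
Proof.
move=> xF; have [|M Mc] := @face_lift B x.
  by move=> F FN FB; rewrite xF.
have MB : RB B (zR (interior_pt B *+ M)) by apply/NB_RB/NBMn/interior_NB.
have [|c [_ cE]] := cone_RB Mc.
  apply: face_of_normals => // F FN FB.
  by rewrite dotDr xF // (dot_RB FB MB) addr0.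
by rewrite -(addrK (zR (interior_pt B *+ M)) x); apply: RBB => //; exists c.
Qed.

Lemma face_span_C v : (forall F, facet_normal F -> vanish_on B F -> dot (zC F) v = 0) -> CB B v.
Proof.
move=> vF.
have [|c cE] := @face_span (map_mx (@complex.Re R) v).
  by move=> F FN FB; rewrite -Re_dot vF.
have [|e eE] := @face_span (map_mx (@complex.Im R) v).
  by move=> F FN FB; rewrite -Im_dot vF.
exists (fun i => Complex (c i) (e i)); apply/rowP => j.
apply/eqP; rewrite eq_complex summxE Re_sum Im_sum.
move/rowP: cE => /(_ j); move/rowP: eE => /(_ j); rewrite !mxE !summxE => -> ->.
by apply/andP; split; apply/eqP; apply: eq_bigr => i _; rewrite !mxE ?Re_mulz ?Im_mulz.
Qed.

(** With [u] the conductor, z - u is in the cone by the facet inequalities and on the face by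
    [face_of_normals], so it has nonnegative coefficients on the generators of the face. *)
Lemma conductor_face : exists N : nat, forall z, ZB B z ->
  (forall F, facet_normal F -> ~~ vanish_on B F -> N%:Z <= dot F z) -> NB B z.
Proof.
have [fs fsP] := normals_finite R hA.
have [u uB uP] := @conductor R d A B.
have [N NP] : exists N : nat, forall F, F \in fs -> dot F u <= N%:Z.
  apply: uniform_bound => [F M N MN|F _]; first by move=> h; apply: le_trans h _.
  by exists (absz (dot F u)); rewrite abszE ler_norm.
exists N => z zB zN.
have overE F : vanish_on B F -> dot (zR F) (zR z - zR u) = 0.
  by move=> FB; rewrite dotBr !dot_zR !(dot_ZB FB) ?subrr //; exact: NB_ZB.
have zuc : in_cone (zR z - zR u).
  apply/(cone_normals hA) => F FN; have [/overE ->|FB] := boolP (vanish_on B F) => //.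
  rewrite dotBr !dot_zR subr_ge0 ler_int; apply: le_trans (zN F FN FB).
  by apply: NP; apply/fsP.
have [|c [c0 cE]] := cone_RB zuc; first by apply: face_of_normals => // F _; exact: overE.
by apply: (uP z c) => //; rewrite -cE addrC subrK.
Qed.

End Functional.

Lemma ZB_generates z : ZB xpredT z.
Proof. by have [c cE] := hA z; exists c. Qed.

Lemma deep_NA : exists N : nat, forall z,
  (forall F, facet_normal F -> N%:Z <= dot F z) -> inNA z.
Proof.
have l0 i : 0 <= dot 0 (gen i) by rewrite dot0l.
have [N NP] := conductor_face l0; exists N => z zN.
apply: (@NB_inNA _ _ (face_idx 0)); apply: NP => [|F FN _]; last exact: zN.
have [c ->] := ZB_generates z; exists c; apply: eq_bigl => i.
by rewrite /face_idx dot0l eqxx.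
Qed.

(** Adding a multiple of [interior_pt B], an element of the group, raises the values on all facets
    not containing [B] until [deep_NA] applies. The multiple depends on [z], the threshold does
    not. *)
Lemma far_NA_ZB : exists N : nat, forall B z,
  (forall F, facet_normal F -> vanish_on B F -> N%:Z <= dot F z) ->
  exists x y : 'rV[int]_d, [/\ inNA x, ZB B y & z = x + y].
Proof.
have [fs fsP] := normals_finite R hA; have [N NP] := deep_NA.
exists N => B z zN.
have [M MP] : exists M : nat, forall F, F \in fs -> N%:Z - dot F z <= M%:Z.
  apply: uniform_bound => [F M M' MM|F _]; first by move=> h; apply: le_trans h _.
  by exists (absz (N%:Z - dot F z)); rewrite abszE ler_norm.
exists (z + interior_pt B *+ M), (- (interior_pt B *+ M)); split; last by rewrite addrK.
  apply: NP => F FN; rewrite dotDr dotMnr.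
  have [FB|FB] := boolP (vanish_on B F); first by rewrite interior_vanish // mul0rn addr0 zN.
  have := MP F (iffRL (fsP F) FN); have := interior_pos FN FB.
  rewrite -mulr_natr natz.
  have key (a b N' M' : int) : 1 <= a -> N' - b <= M' -> 0 <= M' -> N' <= b + a * M' by nia.
  by move=> h1 h2; apply: key.
by apply/ZBN/NB_ZB/NBMn/interior_NB.
Qed.

(** The semigroup F(NA) contains two consecutive integers, the values m and m + 1 of [u] and
    [z0 + u]. *)
Lemma large_values : exists N : nat, forall F (k : int), facet_normal F -> N%:Z <= k ->
  exists2 z, inNA z & dot F z = k.
Proof.
have [fs fsP] := normals_finite R hA.
have [N NP] : exists N : nat, forall F, F \in fs -> forall k : int, N%:Z <= k ->
    exists2 z, inNA z & dot F z = k.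
  apply: uniform_bound => [F M M' MM h k kM|F /fsP FN].
    by apply: h; apply: le_trans kM.
  have [_ [z0 z01] _] := FN.
  have [u uA z0uA] := ZB_NB_add (ZB_generates z0).
  have [m mE] : exists m : nat, dot F u = m%:Z.
    have := dot_NB_ge0 FN uA; case: (dot F u) => // m _; by exists m.
  (* With quotient q and remainder r of k by m, k = (q - r) m + r (m + 1); if m > 0, k >= m^2 gives
     r < m <= q. *)
  exists (m * m)%N => -[k|k]; last by lia.
  rewrite lez_nat => kmm.
  exists (u *+ (k %/ m - k %% m) + (z0 + u) *+ (k %% m)).
    by apply/inNAP; apply: NBD; apply: NBMn.
  rewrite dotDr (dotMnr F u) (dotMnr F (z0 + u)) (dotDr F z0) z01 mE.
  rewrite -(mulr_natr m%:Z) -(mulr_natr (1 + m%:Z)) !natz.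
  (* Division by 0 returns quotient 0 and remainder k, which leaves k copies of [z0 + u], of value 1
     each. *)
  have [m0|m0] := posnP m; first by rewrite m0 modn0 mul0r add0r addr0 mul1r.
  have rq : (k %% m <= k %/ m)%N.
    by apply: leq_trans (ltnW (ltn_pmod k m0)) _; rewrite leq_divRL.
  rewrite -subzn // [X in _ = Posz X](divn_eq k m) PoszD PoszM.
  by move: (Posz (k %/ m)%N) (Posz (k %% m)%N) => q r; ring.
by exists N => F k /fsP FN; exact: NP.
Qed.

End Faces.

(** * Annihilators *)

Section Weights.
Variables (R : realType) (d : nat) (A : seq 'rV[int]_d).
Local Notation C := (complex R).
Local Notation n := (size A).
Local Notation zR := (@Defs.zR R d).
Local Notation zC := (@Defs.zC R d).
Local Notation gen := (@gen R d A).
Local Notation in_cone := (@in_cone R d A).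
Local Notation facet_normal := (@facet_normal R d A).
Local Notation RB := (@RB R d A).
Local Notation CB := (@CB R d A).
Local Notation ZB := (@ZB d A).
Local Notation inNA := (@inNA d A).
Local Notation inE := (@Defs.inE R d A).
Local Notation Up := (@Up R d A).
Local Notation vanish_on := (@vanish_on d A).
Local Notation face_idx := (@face_idx R d A).
Implicit Types (F z u b c : 'rV[int]_d) (alpha lam v : 'rV[C]_d).
Implicit Types (tau sigma : 'rV[R]_d -> Prop).
Hypothesis hA : generates A.

Lemma zC_shiftK alpha b : alpha + zC b + zC (- b) = alpha.
Proof. by rewrite zCN addrK. Qed.

(* If [alpha + b - lam] avoids [NA + Z(A \cap tau)], an element of [Iset b]
   vanishes on a translate of [N(A \cap tau)] whose Zariski closure contains
   [alpha]. *)
Lemma Up_inE alpha b tau lam : Up alpha b -> inE tau alpha lam -> inE tau (alpha + zC b) lam.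
Proof.
move=> [h [Ih h0]]; pose B : pred 'I_n := fun i => `[< tau (gen i) >].
have tauB i : tau (gen i) <-> B i by split=> /asboolP.
move=> /(inEP tauB)[lamB [x [y [xA yB lamE]]]]; apply/(inEP tauB); split=> //.
have [k kA] : exists k : 'I_n -> nat, inNA (b + (x + \sum_(i | B i) A`_i *+ k i)).
  apply: contra_notP (elimN eqP h0) => /forallNP noA.
  have hz : forall k : 'I_n -> nat,
      ev h (zC x + \sum_(i <- index_enum 'I_n | B i) (k i)%:R *: zC A`_i) = 0.
    move=> k; have -> : zC x + \sum_(i | B i) (k i)%:R *: zC A`_i =
        zC (x + \sum_(i | B i) A`_i *+ k i).
      by rewrite zCD zC_sum; congr (_ + _); apply: eq_bigr => i _; rewrite zCMn.
    apply: Ih (noA k); apply: inNAD => //; exact: NB_inNA (NB_sum _ _).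
  have [e eE] : CB B (zC y + lam) by apply: CBD => //; exact: ZB_CB.
  have := ev_span_eq0 (index_enum_uniq _) hz e; rewrite -eE addrA -zCD -lamE.
  by rewrite subrK.
exists (b + (x + \sum_(i | B i) A`_i *+ k i)), (y - \sum_(i | B i) A`_i *+ k i).
split=> //; first by apply: ZBB => //; apply/NB_ZB/NB_sum.
rewrite addrAC lamE -zCD; congr zC.
by move: (\sum_(_ | _) _) => S; apply/rowP => j; rewrite !mxE; ring.
Qed.

Lemma face_data tau : is_face A tau -> exists l : 'rV[R]_d,
  [/\ forall i, 0 <= dot l (gen i), forall x, tau x <-> in_cone x /\ dot l x = 0
    & forall i, tau (gen i) <-> face_idx l i].
Proof.
move=> [l [l0 tauE]]; exists l; split=> // i; first exact/l0/in_cone_gen.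
rewrite tauE; split=> [[_ /eqP //]|/eqP li]; split=> //; exact: in_cone_gen.
Qed.

Lemma face_of_functional (l : 'rV[R]_d) : (forall i, 0 <= dot l (gen i)) ->
  is_face A (fun x => in_cone x /\ dotR l x = 0) /\
  forall i, (in_cone (gen i) /\ dotR l (gen i) = 0) <-> face_idx l i.
Proof.
move=> l0; split.
  by exists l; split=> // x /(cone_ge0 l0).
by move=> i; split=> [[_ /eqP //]|/eqP li]; split=> //; exact: in_cone_gen.
Qed.

(* If two such [z] differ by a vector positive off [T], then [T] is the set of
   facets containing a face tau with [alpha - z] in C(A \cap tau); the [b + z]
   fall into finitely many classes modulo Z(A \cap tau), each meeting [NA], and
   a class that meets [NA] contains all its points far from the facets off [T].
   Otherwise the values off [T] are bounded and [N] can be chosen beyond them. *)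
Lemma transfer alpha b (fs : seq 'rV[int]_d) (T : pred 'rV[int]_d) :
  (forall tau lam, is_face A tau -> inE tau alpha lam -> inE tau (alpha + zC b) lam) ->
  (forall F, F \in fs <-> facet_normal F) ->
  exists N : nat, forall z, inNA z ->
    (forall F, F \in fs -> T F -> dot (zC F) alpha = (dot F z)%:~R) ->
    (forall F, F \in fs -> ~~ T F -> N%:Z <= dot F z) -> inNA (b + z).
Proof.
move=> HE fsP.
pose agree z := inNA z /\ forall F, F \in fs -> T F -> dot (zC F) alpha = (dot F z)%:~R.
have [[z0 [z0A z0T]]|no0] := EM (exists z0, agree z0); last first.
  by exists 0%N => z zA zT _; case: no0; exists z.
have [[z1 [[z1A z1T] z1gt]]|no1] := EM (exists z1, agree z1 /\
    forall F, F \in fs -> ~~ T F -> dot F z0 < dot F z1); last first.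
  have [N NP] : exists N : nat, forall F, F \in fs -> dot F z0 < N%:Z.
    apply: uniform_bound => [F M N MN h|F _]; first by apply: lt_le_trans h _.
    exists (absz (dot F z0)).+1; have := ler_norm (dot F z0); rewrite -abszE; lia.
  exists N => z zA zT zN; case: no1; exists z; split=> // F Ffs FT.
  exact: lt_le_trans (NP F Ffs) (zN F Ffs FT).
(* The sum of the forms in [T] cuts out the intersection of their facets, the face tau. *)
pose l : 'rV[R]_d := \sum_(F <- fs | T F) zR F.
have l0 i : 0 <= dot l (gen i).
  rewrite dot_suml big_seq_cond sumr_ge0 // => F /andP[/fsP[F0 _ _] _].
  by rewrite dot_gen ler0z.
have [tau_face tauB] := face_of_functional l0.
set tau := (X in is_face A X) in tau_face; set B := face_idx l in tauB.
have T_over F : F \in fs -> T F -> vanish_on B F.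
  move=> Ffs TF; apply/vanish_onP => i /eqP; rewrite dot_suml big_seq_cond => /eqP.
  rewrite psumr_eq0; last by move=> F' /andP[/fsP[F0 _ _] _]; rewrite dot_gen ler0z.
  by move=> /allP/(_ F Ffs); rewrite Ffs TF /= dot_gen intr_eq0 => /eqP.
have z10 F : F \in fs -> T F -> dot F z1 = dot F z0.
  by move=> Ffs TF; apply: (@intr_inj C); rewrite -z0T // -z1T.
(* z1 - z0 lies on tau and is positive on every facet off [T], so none of these contains tau. *)
have over_T F : F \in fs -> vanish_on B F -> T F.
  move=> Ffs FB; apply: contraTT isT => TF.
  have vcone : in_cone (zR (z1 - z0)).
    apply/(cone_normals hA) => F' /fsP F'fs; rewrite dot_zR ler0z dotBr subr_ge0.
    have [F'T|F'T] := boolP (T F'); first by rewrite z10.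
    by rewrite ltW // z1gt.
  have lv : dot l (zR (z1 - z0)) = 0.
    rewrite dot_suml big_seq_cond big1 // => F' /andP[F'fs F'T].
    by rewrite dot_zR dotBr z10 // subrr.
  have [e [_ eE]] := cone_RB l0 vcone lv.
  have := dot_RB FB (ex_intro _ e eE); rewrite dot_zR => /eqP.
  by rewrite intr_eq0 dotBr subr_eq0 gt_eqF // z1gt.
have [N0 N0P] := conductor_face hA l0; rewrite -/B in N0P.
have [ws wsP] := @finite_index R d A B.
(* Each class that meets NA gets a witness [x]; there are finitely many classes, so [M] bounds the
   values of all witnesses. *)
have [M MP] : exists M : nat, forall w, w \in ws ->
    (exists x, inNA x /\ ZB B (z0 + b + w - x)) ->
    exists x, [/\ inNA x, ZB B (z0 + b + w - x) & forall F, F \in fs -> dot F x <= M%:Z].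
  apply: uniform_bound => [w M N MN h /h[x [xA xB xM]]|w _].
    by exists x; split=> // F /xM /le_trans; apply.
  have [[x [xA xB]]|nox] := EM (exists x, inNA x /\ ZB B (z0 + b + w - x)); last by exists 0%N.
  have [M MP] : exists M : nat, forall F, F \in fs -> dot F x <= M%:Z.
    apply: uniform_bound => [F M N MN h|F _]; first by apply: le_trans h _.
    by exists (absz (dot F x)); rewrite abszE ler_norm.
  by exists M => _; exists x.
have [K KP] : exists K : nat, forall F, F \in fs -> - dot F b <= K%:Z.
  apply: uniform_bound => [F M' N MN h|F _]; first by apply: le_trans h _.
  by exists (absz (- dot F b)); rewrite abszE ler_norm.
(* [K] pays for [b], [M] for the witness [x']: off [T] the values of b + z - x' are at least the
   threshold [N0] of the face. *)
exists (N0 + M + K)%N => z zA zT zN.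
have span u : (forall F, F \in fs -> T F -> dot (zC F) alpha = (dot F u)%:~R) ->
    CB B (alpha - zC u).
  move=> uT; apply: (face_span_C hA l0) => F /fsP Ffs FB.
  by rewrite dotBr dot_zC (uT F) ?subrr //; exact: over_T.
have : inE tau alpha (alpha - zC z).
  apply/(inEP tauB); split; first exact: span.
  by exists z, 0; split=> //; [exact: ZB0|rewrite opprB addrC subrK addr0].
move=> /(HE _ _ tau_face)/(inEP tauB)[_ [x [y [xA yB]]]].
have -> : alpha + zC b - (alpha - zC z) = zC (b + z).
  by rewrite zCD; apply/rowP => j; rewrite !mxE; ring.
move=> /zC_inj bzE.
have zz0 : RB B (zR (z - z0)).
  apply/CB_RB; have -> : zC (z - z0) = (alpha - zC z0) - (alpha - zC z).
    by rewrite zCD zCN opprB [RHS]addrC addrA subrK.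
  by apply: CBB; apply: span.
have [w wws wB] := wsP _ zz0.
have E u : z0 + b + w - u = (b + z - u) - (z - z0 - w).
  by apply/rowP => j; rewrite !mxE; ring.
have [|x' [x'A x'B x'M]] := MP w wws.
  exists x; split=> //; rewrite E; apply: ZBB => //.
  by rewrite bzE addrAC subrr add0r.
rewrite -(subrK x' (b + z)); apply: inNAD => //; apply/NB_inNA/N0P.
  have := ZBD x'B wB; rewrite E subrK; exact.
move=> F /fsP Ffs FB; rewrite dotBr dotDr.
have TF : ~~ T F by apply: contra FB => TF; exact: T_over.
have := zN F Ffs TF; have := KP F Ffs; have := x'M F Ffs; lia.
Qed.

Definition linp F : mpoly d C := \sum_(j < d) ((F 0 j)%:~R)%:MP * 'X_j.

Lemma ev_linp F v : ev (linp F) v = dot (zC F) v.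
Proof. by rewrite ev_sum; apply: eq_bigr => j _; rewrite evM evC evXU mxE. Qed.

(* The polynomial vanishes on all hyperplanes [F = k], [k < N], that avoid
   [alpha]; [transfer] handles the points of [NA] it misses. *)
Lemma inE_Up alpha b :
  (forall tau lam, is_face A tau -> inE tau alpha lam -> inE tau (alpha + zC b) lam) ->
  Up alpha b.
Proof.
move=> HE; have [fs fsP] := normals_finite R hA.
(* One threshold for all sets of facets, encoded as bit tuples so that they form a finite list. *)
have [N NP] : exists N : nat, forall m : (size fs).-tuple bool,
    m \in enum {: (size fs).-tuple bool} -> forall z, inNA z ->
    (forall F, F \in fs -> nth false m (index F fs) -> dot (zC F) alpha = (dot F z)%:~R) ->
    (forall F, F \in fs -> ~~ nth false m (index F fs) -> N%:Z <= dot F z) -> inNA (b + z).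
  apply: uniform_bound => [m M N MN h z zA zT zN|m _].
    by apply: h => // F Ffs FT; apply: le_trans (zN F Ffs FT).
  exact: (transfer (fun F => nth false m (index F fs)) HE fsP).
exists (\prod_(F <- fs) \prod_(k < N | dot (zC F) alpha != k%:R) (linp F - k%:R%:MP)).
split; last first.
  rewrite ev_prod prodf_seq_neq0; apply/allP => F _; rewrite ev_prod /=.
  by apply/prodf_neq0 => k; rewrite evB ev_linp evC subr_eq0.
move=> z zA zbA; apply/eqP; apply: contra_notT zbA.
rewrite ev_prod prodf_seq_neq0 => /allP fz.
(* The facets on which [z] and [alpha] agree; on the others a value below [N] would make a factor
   vanish at [z]. *)
pose T F := dot (zC F) alpha == (dot F z)%:~R.
apply: (NP [tuple of map T (in_tuple fs)]) => //; first by rewrite mem_enum.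
  by move=> F Ffs; rewrite (nth_map 0) ?index_mem //= nth_index // => /eqP.
move=> F Ffs; rewrite (nth_map 0) ?index_mem //= nth_index // => FT.
have := fz F Ffs; rewrite ev_prod /= => /prodf_neq0 Fz.
have := dot_NA_ge0 (iffLR (fsP F) Ffs) zA; move: FT; rewrite /T.
case: (dot F z) (dot_zC R F z) => // k kz kT _; rewrite lez_nat leqNgt; apply/negP => kN.
by have := Fz (Ordinal kN) kT; rewrite evB ev_linp evC kz subrr eqxx.
Qed.

(** * F_+, F_- and Face(alpha) in terms of normals *)

Definition plus alpha F := exists z, inNA z /\ dot (zC F) alpha = (dot F z)%:~R.
Definition minus alpha F := (exists k : int, dot (zC F) alpha = k%:~R) /\ ~ plus alpha F.

Lemma FplusP alpha F sigma : facet_normal F ->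
  (forall x, sigma x <-> facet_of A F x) -> Fplus A alpha sigma <-> plus alpha F.
Proof.
move=> FN sE; split=> [|aF F' F's]; first by apply; exact: facet_form_facet sE.
by rewrite (facet_form_uniq hA FN sE F's).
Qed.

Lemma FminusP alpha F sigma : facet_normal F ->
  (forall x, sigma x <-> facet_of A F x) -> Fminus A alpha sigma <-> minus alpha F.
Proof.
move=> FN sE; split=> [|aF F' F's]; first by apply; exact: facet_form_facet sE.
by rewrite (facet_form_uniq hA FN sE F's).
Qed.

Lemma RposP alpha (gamma : 'rV[R]_d) : Rpos A alpha gamma <->
  forall F, facet_normal F -> (plus alpha F -> 0 < dot (zR F) gamma) /\
                              (minus alpha F -> dot (zR F) gamma < 0).
Proof.
split=> [g F FN|g sigma sf].
  have [gp gm] := g _ (facet_of_facet FN); have Ff := facet_of_form FN.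
  have sE (x : 'rV[R]_d) : facet_of A F x <-> facet_of A F x by [].
  by split=> [/(FplusP _ FN sE)/gp|/(FminusP _ FN sE)/gm]; apply.
have [F [FN sE]] := facet_normalP hA sf; have [gp gm] := g F FN.
by split=> [/(FplusP _ FN sE)/gp|/(FminusP _ FN sE)/gm] ? F' /(facet_form_uniq hA FN sE) ->.
Qed.

Lemma inE_plus alpha tau (B : pred 'I_n) lam F : (forall i, tau (gen i) <-> B i) ->
  inE tau alpha lam -> vanish_on B F -> plus alpha F.
Proof.
move=> tauB /(inEP tauB)[lamB [x [y [xA yB E]]]] FB; exists x; split=> //.
by rewrite -(subrK lam alpha) E dotDr (dot_CB FB lamB) addr0 dot_zC dotDr (dot_ZB FB yB) addr0.
Qed.

(** No other facet contains the facet of [F], so its span is the kernel of [F]. With [inE_plus] this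
    reads F_+ off the sets E_tau, which makes it an invariant of the class. *)
Lemma plus_inE alpha F : facet_normal F -> plus alpha F ->
  exists lam, inE (facet_of A F) alpha lam.
Proof.
move=> FN [z [zA zE]]; have [F0 F1 _] := FN.
have F0R i : 0 <= dot (zR F) (gen i) by rewrite dot_gen ler0z.
have [_ tauB] := face_of_functional F0R.
exists (alpha - zC z); apply/(inEP tauB); split; last first.
  by exists z, 0; split=> //; [exact: ZB0|rewrite opprB addrC subrK addr0].
apply: (face_span_C hA F0R) => F' F'N /vanish_onP F'F.
have -> : F' = F; last by rewrite dotBr zE dot_zC subrr.
have [F'0 F'1 _] := F'N; apply: (normal_uniq hA FN) => // i Fi.
by apply: F'F; apply/eqP; rewrite dot_gen Fi.
Qed.

Lemma inFaceP alpha tau l : is_face A tau ->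
  (forall i, 0 <= dot l (gen i)) -> (forall x, tau x <-> in_cone x /\ dot l x = 0) ->
  (forall i, tau (gen i) <-> face_idx l i) ->
  inFace A alpha tau <-> (exists2 v, CB (face_idx l) v & exists z, alpha - v = zC z) /\
    forall F, facet_normal F -> vanish_on (face_idx l) F -> plus alpha F.
Proof.
move=> tf l0 tauE tauB.
have subE F : facet_normal F ->
    (forall x, tau x -> facet_of A F x) <-> vanish_on (face_idx l) F.
  move=> FN; split=> [tF|FB x /tauE[xc xl]].
    apply/vanish_onP => i /tauB /tF[_ Fi]; apply: (@intr_inj R).
    by rewrite -dot_gen.
  split=> //; have [c [_ cE]] := cone_RB l0 xc xl.
  by apply: (dot_RB FB); exists c.
split=> [[_ [v [/(spanCP tauB) vB vz]] h]|[[v vB vz] h]].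
  split; first by exists v.
  move=> F FN FB; apply/(FplusP _ FN (fun x => iff_refl _)); apply: h.
    exact: facet_of_facet.
  exact/subE.
split=> //; first by exists v; split=> //; apply/(spanCP tauB).
move=> sigma /(facet_normalP hA)[F [FN sE]] ts; apply/(FplusP _ FN sE)/h => //.
by apply/subE => // x /ts/sE.
Qed.

(** * Zero annihilator implies extremeness *)

Lemma annL_zero_dense alpha (f : mpoly d C) : annL_zero A alpha -> f != 0 ->
  exists b, [/\ Up alpha b, Up (alpha + zC b) (- b) & ev f (alpha + zC b) != 0].
Proof.
move=> /annL_zeroP ann f0; apply: contra_notP (elimN eqP f0) => /forallNP nob.
(* The test operator f(s) has degree 0 and acts on each weight space by its value there. *)
have /(congr1 (coefW 0)) : monW 0 f = 0; last by rewrite coef_monWE coefW0.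
apply: ann; first exact/inD_mon/Iset0.
move=> a b bU abU; rewrite coef_monW; case: eqP => [a0|_]; last by rewrite mulr0n ev0.
rewrite -a0 add0r in abU; rewrite mulr1n; apply/eqP; apply: contra_notT (nob b).
by move=> fb; split.
Qed.

Lemma annL_zero_extreme alpha : annL_zero A alpha ->
  extreme A alpha /\ exists gamma, Rpos A alpha gamma.
Proof.
move=> ann; have [fs fsP] := normals_finite R hA.
have [N1 N1P] := far_NA_ZB R hA; have [N2 N2P] := large_values R hA.
(* Values from [N1] on give points of NA + Z(A \cap tau), values from [N2] on lie in F(NA), and the
   successor makes [N] positive. *)
pose N := (N1 + N2).+1.
pose f : mpoly d C := \prod_(F <- fs) \prod_(k < N) (linp F - k%:R%:MP).
have f0 : f != 0.
  rewrite prodf_seq_neq0; apply/allP => F /fsP[_ [z Fz] _] /=; apply/prodf_neq0 => k _.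
  (* [F] takes the value k + 1 at (k + 1) z, so F - k is not the zero polynomial. *)
  apply/eqP => /(congr1 (fun g => ev g (zC (z *+ k.+1)))) /eqP.
  rewrite ev0 evB ev_linp evC dot_zC dotMnr Fz subr_eq0 -[k%:R]/(k%:Z%:~R).
  rewrite eqr_int natz eqz_nat; lia.
have [b [bU bU' fb]] := annL_zero_dense ann f0.
have gap F (k : int) : facet_normal F -> dot (zC F) (alpha + zC b) = k%:~R ->
    k < 0 \/ N%:Z <= k.
  move=> /fsP Ffs; move: fb; rewrite ev_prod prodf_seq_neq0 => /allP/(_ F Ffs) /=.
  rewrite ev_prod => /prodf_neq0 fb FE; case: k FE => k FE; [right|by left].
  rewrite lez_nat leqNgt; apply/negP => kN; have := fb (Ordinal kN) isT.
  by rewrite evB ev_linp evC FE subrr eqxx.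
have EE tau lam : inE tau alpha lam <-> inE tau (alpha + zC b) lam.
  by split=> [/(Up_inE bU)//|/(Up_inE bU')]; rewrite zC_shiftK.
have plusE F : facet_normal F -> plus alpha F <-> plus (alpha + zC b) F.
  move=> FN; have [F0 F1 _] := FN.
  have F0R i : 0 <= dot (zR F) (gen i) by rewrite dot_gen ler0z.
  have [_ tauB] := face_of_functional F0R.
  have FB : vanish_on (face_idx (zR F)) F.
    by apply/vanish_onP => i /eqP; rewrite dot_gen => /eqP; rewrite intr_eq0 => /eqP.
  by split=> /(plus_inE FN)[lam /EE lamE]; exact: inE_plus lamE FB.
have big F (k : int) : facet_normal F -> plus alpha F ->
    dot (zC F) (alpha + zC b) = k%:~R -> N%:Z <= k.
  move=> FN /(plusE F FN)[z [zA zE]] kE.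
  have := dot_NA_ge0 FN zA; move: zE; rewrite kE => /intr_inj <-.
  by case: (gap F k FN kE) => // k0; rewrite leNgt k0.
split; last first.
  exists (map_mx (@complex.Re R) (alpha + zC b)); apply/RposP => F FN.
  have real k : dot (zC F) (alpha + zC b) = k%:~R ->
      dot (zR F) (map_mx (@complex.Re R) (alpha + zC b)) = k%:~R.
    by rewrite -Re_dot => ->; rewrite int_complex.
  split=> [Fp|[[k kE] Fm]].
    have /(plusE F FN)[z [_ zE]] := Fp.
    by rewrite (real _ zE) ltr0z; apply: lt_le_trans (big F _ FN Fp zE).
  have kbE : dot (zC F) (alpha + zC b) = (k + dot F b)%:~R.
    by rewrite dotDr kE dot_zC intrD.
  rewrite (real _ kbE) ltrz0; case: (gap F _ FN kbE) => // Nk.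
  (* A value from [N] on would lie in F(NA) and put [F] in F_+. *)
  case: Fm; apply/(plusE F FN); have [|z zA zE] := N2P F (k + dot F b) FN.
    by apply: le_trans Nk; rewrite /N lez_nat; lia.
  by exists z; rewrite kbE zE.
move=> tau tf; have [l [l0 tauE tauB]] := face_data tf; split.
  move=> /(inFaceP _ tf l0 tauE tauB)[vz Fp]; apply/(EfullP tauB); split=> // v z vB vzE.
  apply/EE/(inEP tauB); split=> //.
  (* On the facets containing tau, z + b takes the values of alpha + b, because [v] contributes 0;
     these are at least [N]. *)
  have [|x [y [xA yB E]]] := N1P (face_idx l) (z + b).
    move=> F FN FB; have := Fp F FN FB => Fpl.
    have [u [_ uE]] := iffLR (plusE F FN) Fpl.
    have := big F _ FN Fpl uE.
    have -> : dot F (z + b) = dot F u.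
      apply: (@intr_inj C); rewrite -uE -dot_zC zCD -vzE.
      by rewrite addrAC dotBr (dot_CB FB vB) subr0.
    by apply: le_trans; rewrite lez_nat /N; lia.
  by exists x, y; split=> //; rewrite addrAC vzE -zCD E.
move=> nF [lam lamE]; apply: nF; apply/(inFaceP _ tf l0 tauE tauB); split.
  by have /(inEP tauB)[lamB [x [y [_ _ E]]]] := lamE; exists lam => //; exists (x + y).
by move=> F _; exact: inE_plus lamE.
Qed.

(** * Extremeness and a point of R_>0(alpha) imply zero annihilator *)

Lemma annL_zero_of_dense alpha :
  (forall a (f : mpoly d C), (forall b, Up alpha b ->
     Up (alpha + zC (a + b)) (- (a + b)) -> ev f (alpha + zC b) = 0) -> f = 0) ->
  annL_zero A alpha.
Proof.
move=> dense; apply/annL_zeroP => P PD Pann; apply: coefWP => a.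
by rewrite coefW0; apply: (dense a) => b; exact: Pann.
Qed.

(** Facets with a non-integral value impose no condition. *)
Definition far (N : int) alpha b := forall F, facet_normal F -> forall k : int,
  dot (zC F) (alpha + zC b) = k%:~R ->
  (plus alpha F -> N <= k) /\ (minus alpha F -> k < 0).

(** If E_tau(alpha) is nonempty, the facets containing tau are in F_+, where the large values allow
    [far_NA_ZB]. If E_tau(alpha + b) is nonempty, these facets have no negative value at alpha + b,
    so tau is in Face(alpha) and fullness supplies [lam]. *)
Lemma far_inE : exists N : int, forall alpha b, extreme A alpha -> far N alpha b ->
  forall tau lam, is_face A tau -> inE tau alpha lam <-> inE tau (alpha + zC b) lam.
Proof.
have [N NP] := far_NA_ZB R hA; exists N%:Z => alpha b ext bfar tau lam tf.
have [l [l0 tauE tauB]] := face_data tf; split=> lamE.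
  have /(inEP tauB)[lamB [x [y [xA yB E]]]] := lamE.
  apply/(inEP tauB); split=> //; have Eb : alpha + zC b - lam = zC (x + y + b).
    by rewrite addrAC E -zCD.
  have [|x' [y' [x'A y'B E']]] := NP (face_idx l) (x + y + b); last first.
    by exists x', y'; split=> //; rewrite Eb E'.
  move=> F FN FB; have [|h _] := bfar F FN (dot F (x + y + b)).
    by rewrite -dot_zC -Eb dotBr (dot_CB FB lamB) subr0.
  by apply: h; exact: inE_plus lamE FB.
have /(inEP tauB)[lamB [x [y [xA yB E]]]] := lamE.
have Ea : alpha - lam = zC (x + y - b).
  by rewrite zCD -E zCN addrAC addrK.
have tF : inFace A alpha tau.
  apply/(inFaceP _ tf l0 tauE tauB); split; first by exists lam => //; exists (x + y - b).
  move=> F FN FB; have [z [zA zE]] := inE_plus tauB lamE FB.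
  have [_ h] := bfar F FN _ zE; apply: contrapT => nF.
  have := dot_NA_ge0 FN zA; rewrite leNgt h //; split=> //.
  exists (dot F (x + y - b)); rewrite -dot_zC -Ea dotBr (dot_CB FB lamB).
  by rewrite subr0.
have [/(_ tF)/(EfullP tauB)[_ full] _] := ext tau tf.
exact: full Ea.
Qed.

Lemma integral_direction alpha (gamma : 'rV[R]_d) : Rpos A alpha gamma ->
  exists c, forall F, facet_normal F ->
    (plus alpha F -> 1 <= dot F c) /\ (minus alpha F -> dot F c <= -1).
Proof.
move=> /RposP g; have [fs fsP] := normals_finite R hA.
(* Rounding M gamma down changes the value of [F] by at most the l1-norm [S F], so a margin of
   [S F + 1] leaves at least 1. *)
pose S F : R := \sum_(j < d) `|zR F 0 j|.
have [M MP] : exists M : nat, forall F, F \in fs -> facet_normal F ->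
    (plus alpha F -> S F + 1 <= M%:R * dot (zR F) gamma) /\
    (minus alpha F -> M%:R * dot (zR F) gamma <= - (S F + 1)).
  apply: uniform_bound => [F M N MN h FN|F /fsP FN].
    have [[gp gm] [hp hm]] := (g F FN, h FN); split=> [Fp|Fm].
      apply: le_trans (hp Fp) _; rewrite ler_wpM2r ?ler_nat //; exact/ltW/gp.
    apply: le_trans _ (hm Fm); rewrite ler_wnM2r ?ler_nat //; exact/ltW/gm.
  have [gp gm] := g F FN.
  have [M MP] := real_bound ((S F + 1) / `|dot (zR F) gamma|); exists M => _; split=> [/gp|/gm] h.
    by move: MP; rewrite gtr0_norm // ler_pdivrMr.
  by move: MP; rewrite ltr0_norm // ler_pdivrMr ?oppr_gt0 // mulrN => ?; rewrite lerNr.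
pose c : 'rV[int]_d := \row_j Num.floor (M%:R * gamma 0 j); exists c => F FN.
have err : `|dot (zR F) (M%:R *: gamma) - (dot F c)%:~R| <= S F.
  rewrite -dot_zR -dotBr; apply: le_trans (ler_norm_sum _ _ _) _.
  apply: ler_sum => j _; rewrite normrM ler_piMr // !mxE.
  by have := floor_itv (M%:R * gamma 0 j); rewrite intrD ler_norml; lra.
have [hp hm] := MP F (iffRL (fsP F) FN) FN.
move: err; rewrite dotZr ler_norml => /andP[e1 e2].
split=> [/hp h|/hm h]; rewrite -(ler_int R) ?intrN; lra.
Qed.

Lemma far_ray (N : int) alpha c : (forall F, facet_normal F ->
    (plus alpha F -> 1 <= dot F c) /\ (minus alpha F -> dot F c <= -1)) ->
  forall b, exists k0, forall k, (k0 <= k)%N -> far N alpha (b + c *+ k).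
Proof.
move=> cF b; have [fs fsP] := normals_finite R hA.
have [k0 k0P] : exists k0, forall F, F \in fs -> forall k, (k0 <= k)%N -> forall m : int,
    dot (zC F) (alpha + zC (b + c *+ k)) = m%:~R ->
    (plus alpha F -> N <= m) /\ (minus alpha F -> m < 0).
  apply: uniform_bound => [F M M' MM h k kM|F /fsP FN].
    by apply: h; apply: leq_trans kM.
  have [cp cm] := cF F FN.
  have E (p m : int) k : dot (zC F) alpha = p%:~R ->
      dot (zC F) (alpha + zC (b + c *+ k)) = m%:~R -> m = p + dot F b + dot F c * k%:Z.
    move=> pE; rewrite dotDr pE dot_zC -intrD => /intr_inj <-.
    by rewrite dotDr dotMnr -mulr_natr natz addrA.
  have [[p pE]|nop] := EM (exists p : int, dot (zC F) alpha = p%:~R); last first.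
    exists 0%N => k _ m _; split=> [[z [_ zE]]|[]//]; case: nop.
    by exists (dot F z).
  (* With q = p + F(b), the value at step k is q + F(c) k. The first summand lifts it to [N] if F(c)
     >= 1; the second, with the successor, brings it below 0 if F(c) <= -1. *)
  exists (absz (N - p - dot F b)%R + absz (p + dot F b)%R).+1 => k kk m /(E _ _ _ pE) ->.
  have arith1 (e q M K : int) : 1 <= e -> 0 <= K -> M - q <= K -> M <= q + e * K by nia.
  have arith2 (e q K : int) : e <= -1 -> 0 <= K -> q < K -> q + e * K < 0 by nia.
  split=> [/cp h|/cm h]; [apply: arith1|apply: arith2] => //; lia.
by exists k0 => k kk F /fsP Ffs m; exact: k0P.
Qed.

Lemma extreme_annL_zero alpha (gamma : 'rV[R]_d) :
  extreme A alpha -> Rpos A alpha gamma -> annL_zero A alpha.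
Proof.
move=> ext /integral_direction[c cF]; apply: annL_zero_of_dense => a f f0.
have [N NP] := far_inE.
have upP b : far N alpha b -> Up alpha b /\ Up (alpha + zC b) (- b).
  move=> /(NP _ _ ext) E; split; apply: inE_Up => tau lam tf; first by move/(E _ _ tf).
  by rewrite zC_shiftK => /(E _ _ tf).
apply: (@ev_lattice_eq0 _ _ f alpha) => b.
(* The same direction [c] serves [b] and [a + b], so far along the line both weights occur in
   L(alpha). There [f] vanishes, hence on the whole line and at its parameter 0, which is alpha +
   b. *)
have [k1 k1P] := far_ray N cF b; have [k2 k2P] := far_ray N cF (a + b).
have := @ev_line_eq0 _ _ f (alpha + zC b) (zC c) (k1 + k2)%N.
move=> /(_ _ 0); rewrite scale0r addr0; apply=> k kk.
rewrite -addrA -zCMn -zCD; apply: f0.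
  by have [] := upP _ (k1P k (leq_trans (leq_addr _ _) kk)).
by rewrite addrA; have [] := upP _ (k2P k (leq_trans (leq_addl _ _) kk)).
Qed.

End Weights.

Theorem theorem8p20 (R : realType) (d : nat) (A : seq 'rV[int]_d)
  (hA : generates A) (alpha : 'rV[complex R]_d) :
  annL_zero A alpha <->
  (extreme A alpha /\ exists gamma : 'rV[R]_d, Rpos A alpha gamma).
Proof.
split=> [|[ext [gamma g]]]; first exact: annL_zero_extreme.
exact: extreme_annL_zero g.
Qed.
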